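(* Let $r, s \ge 2$ be integers and let $0 \le p \le 1$. Let $q$ be the unique root of $q^r + r q^{r-1}(1-q) = p$ in $[0,1]$, and let $$M_{r,s,p} := \max\left\{(1-p^{1/r})^s + s p^{1/r}(1-p^{1/r})^{s-1},\ (1-q)^s\right\}.$$ If $G$ is an $n$-vertex graph with $d(\overline{K}_r; G) \ge p$, then $d(K_s; G) \le M_{r,s,p} + o(1)$. Moreover, the maximum of $d(K_s;G)$ over all $n$-vertex graphs $G$ with $d(\overline{K}_r;G)\ge p$ is attained, up to an additive error $\pm o(1)$, by one of two graphs (or both), one of the form $Q_{n,t}$ and the other of the form $\overline{Q}_{n,t'}$. Here $o(1)$ denotes a quantity tending to $0$ as $n\to\infty$ with $r,s,p$ fixed.
   Context: Graphs are finite and simple. $K_s$ is the complete graph on $s$ vertices and $\overline{K}_s$ is the edgeless graph on $s$ vertices. For a $k$-vertex graph $H$ and an $n$-vertex graph $G$ (with $n\ge k$), $\mathrm{Ind}(H;G) := \{X\subseteq V(G): G[X]\simeq H\}$ and the induced $H$-density is $d(H;G) := |\mathrm{Ind}(H;G)|/\binom{n}{k}$. For integers $a\ge b>0$, $Q_{a,b}$ is the $a$-vertex graph whose edge set is a clique on some $b$ of the vertices (the remaining $a-b$ vertices are isolated), and $\overline{Q}_{a,b}$ is its complement. *)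

(* Defs.v *)
From HB Require Import structures.
From mathcomp Require Import all_boot all_order all_algebra.
From mathcomp Require Import all_classical all_reals all_analysis.
Set Implicit Arguments.
Unset Strict Implicit.
Unset Printing Implicit Defensive.
Import Order.TTheory GRing.Theory Num.Theory.
Local Open Scope ring_scope.

Record sgraph (V : finType) := SGraph {
  edges : {set {set V}};
  edgesP : [forall e in edges, #|e| == 2%N] }.

HB.instance Definition _ (V : finType) := [isSub for @edges V].
HB.instance Definition _ (V : finType) := [Finite of sgraph V by <:].

Definition adj (V : finType) (G : sgraph V) (x y : V) : bool :=
  [set x; y]%SET \in edges G.

Lemma pairs_ofP (V : finType) (P : pred {set V}) :
  [forall e in [set e : {set V} | (#|e| == 2%N) && P e]%SET, #|e| == 2%N].
Proof. by apply/forall_inP => e; rewrite inE => /andP[]. Qed.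

Definition graph_of (V : finType) (P : pred {set V}) : sgraph V :=
  SGraph (pairs_ofP P).

Definition complete (V : finType) : sgraph V := graph_of predT.

Definition edgeless (V : finType) : sgraph V := graph_of pred0.

Definition complement (V : finType) (G : sgraph V) : sgraph V :=
  graph_of (fun e => e \notin edges G).

(* The vertices of the induced subgraph on X form the subtype {x | x \in X}. *)
Definition induced (V : finType) (G : sgraph V) (X : {set V}) :
    sgraph {x : V | x \in X} :=
  graph_of (fun e : {set {x : V | x \in X}} =>
              [set val x | x in e]%SET \in edges G).

Definition isomorphic (U V : finType) (G : sgraph U) (H : sgraph V) : Prop :=
  exists f : U -> V, bijective f /\ forall x y, adj H (f x) (f y) = adj G x y.

Definition Ind (U V : finType) (H : sgraph U) (G : sgraph V) : {set {set V}} :=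
  [set X : {set V} | `[< isomorphic (induced G X) H >]]%SET.

Definition density (R : realType) (U V : finType) (H : sgraph U)
    (G : sgraph V) : R :=
  #|Ind H G|%:R / 'C(#|V|, #|U|)%:R.

(* The clique is placed on the first b of the a vertices. *)
Definition Q (a b : nat) : sgraph 'I_a :=
  graph_of (fun e => e \subset [set i : 'I_a | (i < b)%N]%SET).

Definition Qbar (a b : nat) : sgraph 'I_a := complement (Q a b).

Definition M (R : realType) (r s : nat) (p q : R) : R :=
  let b := p `^ (r%:R^-1) in
  Num.max ((1 - b) ^+ s + s%:R * b * (1 - b) ^+ (s - 1)) ((1 - q) ^+ s).

Definition is_q (R : realType) (r : nat) (p q : R) : Prop :=
  0 <= q <= 1 /\ q ^+ r + r%:R * q ^+ (r - 1) * (1 - q) = p.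

Definition feasible (R : realType) (r : nat) (p : R) (n : nat)
    (G : sgraph 'I_n) : bool :=
  p <= density R (edgeless 'I_r) G.

(* The default value 0 is harmless: densities are nonnegative, and for p <= 1
   and r <= n the edgeless graph on n vertices is feasible. *)
Definition max_density (R : realType) (r s : nat) (p : R) (n : nat) : R :=
  \big[Num.max/0]_(G : sgraph 'I_n | feasible r p G)
     density R (complete 'I_s) G.

(* Main.v *)
Require Import Defs.
From mathcomp Require Import all_boot all_order all_algebra.
From mathcomp Require Import all_classical all_reals all_analysis.
From mathcomp Require Import zify ring lra.
Import Order.TTheory GRing.Theory Num.Theory.
Import numFieldNormedType.Exports.

(** Compressing a graph (moving the edges at u to v whenever possible) decreases
    neither the number of s-cliques nor the number of independent r-sets, so one may
    assume the graph compressed with respect to the order of its vertices. Such a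
    graph is a clique on its first a vertices together with an independent set on
    the other b = 1 - a (in proportion), joined along a monotone staircase; up to
    o(1) both densities become the staircase sums
      I = b^r + r * sum_j psi_j (y_(j+1)^(r-1) - y_j^(r-1)),
      K = a^s + s * sum_j (a - psi_j)^(s-1) (y_(j+1) - y_j),
    with psi nonincreasing. For fixed a and I, a Hardy-type inequality and the
    quasiconcavity of (a^(s-1) - (a - u^(r-1))^(s-1)) / u show that K is largest for a
    staircase with a single step, that is, for three blocks clique / independent /
    clique, or the same with colours exchanged. Along the curve of such three-block
    graphs with constant I, the derivative of K has the sign of
      x^(s-1) - (x+z)^(s-1) + (s-1)(r-1) z x^(s-2),
    which changes at most once, from negative to positive, as z/x decreases. So K is
    largest at an end of the curve, where one of the blocks is empty: these are the
    two graphs of the theorem. *)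

(** * Cliques and independent sets as homogeneous sets *)

(** Stated for a relation instead of a graph, so that independent sets are the cliques of the
    negated relation; testing only [x != y] makes the diagonal irrelevant in both uses. *)
Definition cliques {V : finType} (e : rel V) (k : nat) : {set {set V}} :=
  [set X : {set V} | (#|X| == k) &&
     [forall x in X, forall y in X, (x != y) ==> e x y]]%SET.

Lemma cliquesP {V : finType} (e : rel V) k (X : {set V}) :
  reflect (#|X| = k /\ {in X &, forall x y, x != y -> e x y}) (X \in cliques e k).
Proof.
rewrite inE; apply: (iffP andP) => [[/eqP Xk /forall_inP h]|[Xk h]]; split=> //.
- by move=> x y xX yX xy; have /forall_inP/(_ y yX)/implyP := h x xX; apply.
- exact/eqP.
- by apply/forall_inP => x xX; apply/forall_inP => y yX; apply/implyP; exact: h.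
Qed.

Lemma eq_cliques {V : finType} (e e' : rel V) k : (forall x y, x != y -> e x y = e' x y) ->
  cliques e k = cliques e' k.
Proof.
move=> ee'; apply/setP => X; apply/cliquesP/cliquesP => -[Xk h]; split=> // x y xX yX xy.
  by rewrite -ee'// h.
by rewrite ee'// h.
Qed.

Lemma adj_graph_of (V : finType) (P : pred {set V}) (x y : V) :
  adj (graph_of P) x y = (x != y) && P [set x; y]%SET.
Proof. by rewrite /adj inE cards2; case: (x != y). Qed.

Lemma adj_sym (V : finType) (G : sgraph V) (x y : V) : adj G x y = adj G y x.
Proof. by rewrite /adj finset.setUC. Qed.

Lemma adj_irr (V : finType) (G : sgraph V) (x : V) : adj G x x = false.
Proof.
rewrite /adj; apply/negP => h; have /forall_inP/(_ _ h) := edgesP G.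
by rewrite cards2 eqxx.
Qed.

Lemma adj_induced (V : finType) (G : sgraph V) (X : {set V}) (x y : {x : V | x \in X}) :
  adj (Defs.induced G X) x y = adj G (val x) (val y).
Proof.
rewrite adj_graph_of imsetU1 imset_set1; case: eqVneq => //= <-.
by rewrite adj_irr.
Qed.

(** Between homogeneous graphs of the same kind every bijection is an isomorphism, so only the
    cardinality matters. The boolean [b] treats complete and edgeless graphs together. *)
Lemma Ind_homogeneous (U V : finType) (H : sgraph U) (G : sgraph V) (b : bool) :
  (forall x y, adj H x y = (x != y) && b) ->
  Ind H G = cliques (fun x y => adj G x y == b) #|U|.
Proof.
move=> Hb; apply/setP => X; rewrite inE; apply/asboolP/cliquesP.
  case=> f [fbij fadj]; split.
    by rewrite -(bij_eq_card fbij) card_sig; apply: eq_card => x; rewrite !inE.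
  move=> x y xX yX xy.
  have := fadj (exist _ x xX) (exist _ y yX); rewrite adj_induced/= => <-.
  by rewrite Hb (bij_eq fbij) -val_eqE /= xy eqxx.
case=> XU hX.
have cXU : #|{: {x : V | x \in X}}| = #|U|.
  by rewrite -XU card_sig; apply: eq_card => x; rewrite !inE.
exists (fun x => enum_val (cast_ord cXU (enum_rank x))); split.
  exists (fun y => enum_val (cast_ord (esym cXU) (enum_rank y))) => x.
    by rewrite enum_valK cast_ordK enum_rankK.
  by rewrite enum_valK cast_ordKV enum_rankK.
move=> x y; rewrite adj_induced Hb (inj_eq enum_val_inj) (inj_eq (@cast_ord_inj _ _ _)).
rewrite (inj_eq enum_rank_inj); case: eqVneq => [->|xy]/=; first by rewrite adj_irr.
by rewrite (eqP (hX (val x) (val y) (valP x) (valP y) _)).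
Qed.

Lemma Ind_complete (V : finType) (G : sgraph V) s :
  Ind (complete 'I_s) G = cliques (adj G) s.
Proof.
rewrite (@Ind_homogeneous _ _ _ _ true) ?card_ord => [|x y].
  by apply: eq_cliques => x y _; rewrite eqb_id.
by rewrite adj_graph_of.
Qed.

Lemma Ind_edgeless (V : finType) (G : sgraph V) r :
  Ind (edgeless 'I_r) G = cliques (fun x y => ~~ adj G x y) r.
Proof.
rewrite (@Ind_homogeneous _ _ _ _ false) ?card_ord => [|x y].
  by apply: eq_cliques => x y _; rewrite eqbF_neg.
by rewrite adj_graph_of.
Qed.

(** * Compression *)

(** Outside the pair, [u] keeps the common neighbours and [v] receives the union; the pair itself is
    left alone. *)
Definition compress {V : finType} (u v : V) (e : rel V) : rel V := fun x y =>
  if (x \in [:: u; v]) == (y \in [:: u; v]) then e x y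
  else if x == u then e u y && e v y
  else if x == v then e u y || e v y
  else if y == u then e x u && e x v
  else e x u || e x v.

Lemma compress_sym {V : finType} (u v : V) (e : rel V) : symmetric e ->
  symmetric (compress u v e).
Proof.
move=> esym x y; rewrite /compress eq_sym !inE !(esym y) !(esym x).
by case: (eqVneq x u) (eqVneq y u) (eqVneq x v) (eqVneq y v) => [->|?] [->|?] [?|?] [?|?].
Qed.

(** A clique destroyed by the compression contains [u], avoids [v] and has a vertex [w] not adjacent
    to [v]. Replacing [u] by [v] gives a clique of the new relation which, because of [w], was none
    of the old one; so replaced and surviving cliques never collide. *)
Lemma leq_card_cliques_compress {V : finType} (u v : V) (e : rel V) k :
  u != v -> symmetric e -> #|cliques e k| <= #|cliques (compress u v e) k|.
Proof.
move=> uv symm_e; set e' := compress u v e.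
pose move_to X := (v |: (X :\ u))%SET.
have lost X : X \in cliques e k -> X \notin cliques e' k ->
    [/\ u \in X, v \notin X & exists2 w, w \in X :\ u & ~~ e v w]%SET.
  move=> /cliquesP[Xk Xe] /cliquesP Xe'.
  have [x [y [xX yX xy e'xy]]] : exists x y, [/\ x \in X, y \in X, x != y & ~~ e' x y].
    apply: contrapT => h; apply: Xe'; split=> // x y xX yX xy.
    by apply: contrapT => /negP e'xy; apply: h; exists x, y.
  wlog [xuv yuv] : x y xX yX xy e'xy / x \in [:: u; v] /\ y \notin [:: u; v].
    move=> W; have := e'xy; rewrite /e' /compress.
    have [xuv|xuv] := boolP (x \in _); have [yuv|yuv] := boolP (y \in _); rewrite ?eqxx/= => e''.
    - by rewrite Xe in e''.
    - exact: (W x y).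
    - by apply: (W y x); rewrite // 1?eq_sym// /e' compress_sym.
    - by rewrite Xe in e''.
  have yu : y != u by apply: contraNneq yuv => ->; rewrite inE eqxx.
  have yv : y != v by apply: contraNneq yuv => ->; rewrite !inE eqxx orbT.
  move: e'xy xuv; rewrite /e' /compress (negbTE yuv) => + xuv; rewrite xuv/=.
  have xE := xuv; rewrite !inE in xE.
  case/orP: xE => /eqP xE; rewrite xE ?eqxx; last first.
    rewrite eq_sym (negbTE uv) negb_or.
    by rewrite -xE (Xe x y xX yX xy) andbF.
  rewrite xE in xX xy; rewrite negb_and (Xe u y xX yX xy)/= => evy; split => //.
    by apply: contra evy => vX; rewrite Xe// eq_sym.
  by exists y; rewrite // !inE yu yX.
have kept X : X \in cliques e k -> X \notin cliques e' k -> move_to X \in cliques e' k.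
  move=> Xe Xe'; have [uX vX _] := lost X Xe Xe'.
  have /cliquesP[Xk Xcl] := Xe; apply/cliquesP; split.
    by rewrite cardsU1 !inE (negbTE vX) andbF/= -Xk (cardsD1 u X) uX.
  have old w : w \in (X :\ u)%SET -> [/\ w \in X, w != u & w != v].
    rewrite !inE => /andP[wu wX]; split=> //.
    by apply: contraNneq vX => <-.
  have new w : w \in (X :\ u)%SET -> e' v w.
    move=> /old[wX wu wv]; rewrite /e' /compress !inE eqxx orbT (negbTE wu) (negbTE wv)/=.
    by rewrite eq_sym (negbTE uv) Xcl// eq_sym.
  move=> x y; rewrite !in_setU1 => /orP[/eqP->|xX] /orP[/eqP->|yX]; rewrite ?eqxx// => xy.
  - exact: new.
  - by rewrite /e' compress_sym//; exact: new.
  have [[xX' xu xv] [yX' yu yv]] := (old x xX, old y yX).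
  by rewrite /e' /compress !inE (negbTE xu) (negbTE xv) (negbTE yu) (negbTE yv) Xcl.
pose f X := if X \in cliques e' k then X else move_to X.
have finj : {in cliques e k &, injective f}.
  have crossed X Y : X \in cliques e k -> Y \in cliques e k -> Y \notin cliques e' k ->
      X = move_to Y -> False.
    move=> /cliquesP[_ Xe] Ye Ye' XY; have [_ _ [w wY /negP]] := lost Y Ye Ye'; apply.
    have [_ vY _] := lost Y Ye Ye'.
    apply: Xe; first by rewrite XY setU11.
      by rewrite XY in_setU1 wY orbT.
    by apply: contraNneq vY => ->; move: wY; rewrite !inE => /andP[].
  move=> X Y Xe Ye; rewrite /f; case: ifPn => [Xe'|Xe']; case: ifPn => [Ye'|Ye'] //.
  - by move=> /crossed h; case: h.
  - by move=> /esym /crossed h; case: h.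
  have [uX vX _] := lost X Xe Xe'; have [uY vY _] := lost Y Ye Ye'.
  rewrite /move_to => /(congr1 (fun Z => u |: (Z :\ v))%SET).
  by rewrite !setU1K ?finset.setD1K// !inE ?(negbTE vX) ?(negbTE vY) andbF.
rewrite -(card_in_imset finj); apply/subset_leq_card/fintype.subsetP => _ /imsetP[X Xe ->].
by rewrite /f; case: ifPn => // Xe'; exact: kept.
Qed.

(** Complementation exchanges union and intersection of neighbourhoods. Hence the bound for cliques
    also serves independent sets. *)
Lemma cliques_compl_compress {V : finType} (u v : V) (e : rel V) k : u != v ->
  cliques (fun x y => ~~ compress u v e x y) k = cliques (compress v u (fun x y => ~~ e x y)) k.
Proof.
move=> uv; apply: eq_cliques => x y xy; rewrite /compress !inE.
by case: (eqVneq x u) (eqVneq y u) (eqVneq x v) (eqVneq y v) => [xu|xu] [yu|yu] [xv|xv] [yv|yv];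
  rewrite /= ?eqxx //= ?negb_and ?negb_or 1?orbC 1?andbC //; move: uv;
  rewrite -?xu -?xv -?yu -?yv ?eqxx.
Qed.

(** The potential that rules out endless compression: the weighted degrees of [u] and [v] keep their
    sum, and every other vertex adjacent to [u] but not to [v] exchanges a neighbour of weight [w u]
    for one of weight [w v]. *)
Lemma ltn_weight_compress {V : finType} (u v y : V) (e : rel V) (w : V -> nat) :
  symmetric e -> w u < w v -> y != u -> y != v -> e u y -> ~~ e v y ->
  \sum_y \sum_x w x * e x y < \sum_y \sum_x w x * compress u v e x y.
Proof.
move=> symm_e wuv yu yv euy evy; set e' := compress u v e.
have uv : v != u by apply: contraTneq wuv => ->; rewrite ltnn.
pose T (f : rel V) z := \sum_x w x * f x z.
have Tuv : T e u + T e v = T e' u + T e' v.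
  rewrite -!big_split; apply: eq_bigr => x _; rewrite /= -!mulnDr; congr (_ * _).
  rewrite /e' /compress !inE !eqxx orbT (negbTE uv) /=.
  by case: (x == u); case: (x == v) => //=; case: (e x u) (e x v) => -[].
have Tz z : z != u -> z != v -> T e z + (w v - w u) * (e u z && ~~ e v z) <= T e' z.
  move=> zu zv; rewrite /T (bigD1 u)//= (bigD1 v)//= [leqRHS](bigD1 u)//= [in leqRHS](bigD1 v)//=.
  rewrite (eq_bigr (fun x => w x * e' x z)) => [|x /andP[xu xv]]; last first.
    by rewrite /e' /compress !inE (negbTE xu) (negbTE xv) (negbTE zu) (negbTE zv).
  rewrite /e' /compress !inE !eqxx (negbTE uv) (negbTE zu) (negbTE zv) /=.
  by case: (e u z) (e v z) => -[]/=; lia.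
have split_T f : \sum_z T f z = T f u + T f v + \sum_(z | (z != u) && (z != v)) T f z.
  by rewrite (bigD1 u)//= (bigD1 v)//= addnA.
change (\sum_z T e z < \sum_z T e' z); rewrite !split_T Tuv ltn_add2l.
rewrite (bigD1 y) ?yu//= [ltnRHS](bigD1 y) ?yu//= -addSn leq_add//.
  by have := Tz y yu yv; rewrite euy evy; lia.
apply: leq_sum => z /andP[/andP[zu zv] _].
by apply: leq_trans (Tz z zu zv); rewrite leq_addr.
Qed.

Lemma exists_compressed {n : nat} (e : rel 'I_n) r s : symmetric e ->
  exists2 e' : rel 'I_n, symmetric e' /\
      (forall u v y : 'I_n, v < u -> y != u -> y != v -> e' u y -> e' v y) &
    #|cliques e s| <= #|cliques e' s| /\
    #|cliques (fun x y => ~~ e x y) r| <= #|cliques (fun x y => ~~ e' x y) r|.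
Proof.
move=> symm_e.
(* Relations are coded by finite functions, so that a potential has a maximiser among them. *)
pose rel_of (P : {ffun 'I_n * 'I_n -> bool}) x y := P (x, y).
pose good P := [&& [forall x, forall y, rel_of P x y == rel_of P y x],
  #|cliques e s| <= #|cliques (rel_of P) s| &
  #|cliques (fun x y => ~~ e x y) r| <= #|cliques (fun x y => ~~ rel_of P x y) r|].
have goodP P : reflect [/\ symmetric (rel_of P),
    #|cliques e s| <= #|cliques (rel_of P) s| &
    #|cliques (fun x y => ~~ e x y) r| <= #|cliques (fun x y => ~~ rel_of P x y) r|]
    (good P).
  apply: (iffP and3P) => -[h1 h2 h3]; split=> //.
    by move=> x y; have /forallP/(_ y)/eqP := forallP h1 x.
  by apply/forallP => x; apply/forallP => y; apply/eqP.
pose code (f : rel 'I_n) : {ffun 'I_n * 'I_n -> bool} := [ffun p => f p.1 p.2].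
have codeE f : rel_of (code f) = f.
  by apply/funext => x; apply/funext => y; rewrite /rel_of ffunE.
have good0 : good (code e) by apply/goodP; rewrite codeE.
(* The weight [n - x] favours small vertices: at a maximum of [W], compressing towards a smaller
   vertex cannot move an edge. *)
pose W P := \sum_y \sum_(x < n) (n - x) * rel_of P x y.
case: (arg_maxnP W good0) => P /goodP[Psym Pcl Pin] Pmax.
exists (rel_of P); last by [].
split=> // u v y vu yu yv euy; apply: contraT => evy.
have uv : u != v by rewrite -val_eqE gtn_eqF.
have /Pmax : good (code (compress u v (rel_of P))).
  apply/goodP; rewrite codeE; split; first exact: compress_sym.
    exact/(leq_trans Pcl)/leq_card_cliques_compress.
  rewrite cliques_compl_compress//; apply/(leq_trans Pin)/leq_card_cliques_compress.
    by rewrite eq_sym.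
  by move=> a b; rewrite Psym.
rewrite /= leqNgt => /negP; case.
rewrite /W codeE; apply: (ltn_weight_compress _ _ y) => //.
by have := ltn_ord u; lia.
Qed.

(** * Counting in compressed graphs *)

(** Removing from a clique its vertex of largest rank leaves [k] neighbours of lower rank. *)
Lemma leq_card_cliques_last {V : finType} (e : rel V) (rk : V -> nat) k :
  injective rk -> symmetric e ->
  #|cliques e k.+1| <= \sum_j 'C(#|[set i | (rk i < rk j) && e i j]%SET|, k).
Proof.
move=> rk_inj symm_e; pose D j := [set i | (rk i < rk j) && e i j]%SET.
pose S := [set p : V * {set V} | (p.2 \subset D p.1) && (#|p.2| == k)]%SET.
have cardS : #|S| = \sum_j 'C(#|D j|, k).
  under eq_bigr do rewrite -cards_draws -sum1_card.
  rewrite (pair_big_dep xpredT) -sum1_card /=.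
  by apply: eq_bigl => p; rewrite !inE.
rewrite -cardS; apply: leq_trans (leq_imset_card (fun p => p.1 |: p.2)%SET _).
apply/subset_leq_card/fintype.subsetP => X /cliquesP[Xk Xe].
have /card_gt0P[x0 x0X] : 0 < #|X| by rewrite Xk.
case: (arg_maxnP (fun x => rk x) x0X) => j jX jmax.
apply/imsetP; exists (j, X :\ j)%SET; last by rewrite /= finset.setD1K.
rewrite !inE /= -(eqn_add2l 1) -[1 + _]/(true + _) -[in true + _]jX -cardsD1 Xk eqxx andbT.
apply/fintype.subsetP => i; rewrite !inE => /andP[ij iX].
rewrite Xe// andbT ltn_neqAle (inj_eq rk_inj) ij /=; exact: jmax.
Qed.

(** * Inequalities for powers and power sums of natural numbers *)

Lemma ffact_leq_exp n k : n ^_ k <= n ^ k.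
Proof.
elim: k n => // k IH n; rewrite ffactnS expnS leq_mul2l; apply/orP; right.
by apply: leq_trans (IH _) _; case: k {IH} => // k; rewrite leq_exp2r// leq_pred.
Qed.

Lemma fact_bin_leq_exp n k : k`! * 'C(n, k) <= n ^ k.
Proof. by rewrite mulnC bin_ffact ffact_leq_exp. Qed.

Lemma expnS_step k j : k.+1 * j ^ k + j ^ k.+1 <= j.+1 ^ k.+1.
Proof.
elim: k => [|k IH]; first by rewrite mul1n expn0 !expn1 add1n.
rewrite [leqRHS]expnS; apply: leq_trans (leq_mul (leqnn _) IH).
rewrite !expnS; nia.
Qed.

Lemma sum_exp_leq k a : k.+1 * (\sum_(0 <= j < a) j ^ k) <= a ^ k.+1.
Proof.
elim: a => [|a IH]; first by rewrite big_geq// muln0.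
rewrite big_nat_recr//= mulnDr; apply: leq_trans (expnS_step k a).
by rewrite addnC leq_add2l.
Qed.

(** The increments of the [l]-th power grow, so the marked positions carry at least the sum of
    equally many initial increments, which telescopes. *)
Lemma leq_exp_sum_steps l (P : pred nat) b : 0 < l ->
  (\sum_(0 <= c < b) P c) ^ l <= \sum_(0 <= c < b) P c * (c.+1 ^ l - c ^ l).
Proof.
move=> l0; elim: b => [|b IH]; first by rewrite !big_geq// exp0n.
rewrite !big_nat_recr//=; case: (P b); last by rewrite mul0n !addn0.
rewrite mul1n addn1.
have Pb : \sum_(0 <= c < b) P c <= b.
  apply: (@leq_trans (\sum_(0 <= c < b) 1)); last by rewrite sum_nat_const_nat subn0 muln1.
  by apply: leq_sum => c _; case: (P c).
set x := \sum_(0 <= c < b) P c in IH Pb *.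
(* Since [x <= b], the increment at [x] is at most the one at [b]. *)
suff : x.+1 ^ l + b ^ l <= x ^ l + b.+1 ^ l.
  have : b ^ l <= b.+1 ^ l by rewrite leq_exp2r.
  move: IH; move: (x ^ l) (x.+1 ^ l) (b ^ l) (b.+1 ^ l) => A B C D; lia.
elim: l l0 {IH} => // l IHl _; have [->|l0] := posnP l; first by rewrite !expn1; lia.
have := IHl l0; rewrite !expnS.
have : x ^ l <= b ^ l by rewrite leq_exp2r.
have : x.+1 ^ l <= b.+1 ^ l by rewrite leq_exp2r.
have : x ^ l <= x.+1 ^ l by rewrite leq_exp2r.
have : b ^ l <= b.+1 ^ l by rewrite leq_exp2r.
move: (x ^ l) (x.+1 ^ l) (b ^ l) (b.+1 ^ l) => A B C D; nia.
Qed.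

Lemma sum_nat_reflect (F : nat -> nat) a N : a <= N ->
  \sum_(a <= j < N) F j = \sum_(0 <= c < N - a) F (N - c.+1).
Proof.
move=> aN; rewrite big_nat_rev -{1}(add0n a) big_addn.
by apply: eq_big_nat => c /andP[_ cb]; congr F; lia.
Qed.

Lemma sum_nat_bool_leq (P : pred nat) a b : \sum_(a <= i < b) P i <= b - a.
Proof.
apply: (@leq_trans (\sum_(a <= i < b) 1)); last by rewrite sum_nat_const_nat muln1.
by apply: leq_sum => i _; case: (P i).
Qed.

(** The initial [a] vertices form a clique and the others, the tail, an independent set. The
    function [f] is the staircase of missing edges between them. *)
Lemma compressed_staircase (N : nat) (E : rel nat) :
  symmetric E ->
  (forall u v y, v < u < N -> y < N -> y != u -> y != v -> E u y -> E v y) ->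
  exists a (f : nat -> nat),
  [/\ a <= N,
      forall i j, i <= j < N - a -> f j <= f i,
      forall j, j < N - a -> f j <= a,
      forall m, m.+1 * (\sum_(0 <= j < N) (\sum_(0 <= i < j) E i j) ^ m) <=
        a ^ m.+1 + m.+1 * \sum_(0 <= c < N - a) (a - f c) ^ m &
      forall l, 0 < l ->
        l.+1 * (\sum_(0 <= i < N) (\sum_(i.+1 <= k < N) ~~ E i k) ^ l) <=
        (N - a) ^ l.+1 + l.+1 * \sum_(0 <= c < N - a) f c * (c.+1 ^ l - c ^ l)].
Proof.
move=> symE compE.
(* The least such [k] is the first vertex with an earlier nonneighbour; the value [N] covers the
   case where all vertices form a clique. *)
pose stops k := (k == N) || [exists i : 'I_k, ~~ E i k].
have ex_stop : exists k, stops k by exists N; rewrite /stops eqxx.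
have [a [aN clique_a stop_a]] : exists a, [/\ a <= N,
    forall i j, i < j < a -> E i j & a < N -> exists2 i, i < a & ~~ E i a].
  case: (ex_minnP ex_stop) => a sa amin; exists a; split.
  - by apply: amin; rewrite /stops eqxx.
  - move=> i j /andP[ij ja]; apply: contraT => Eij.
    have := amin j; rewrite leqNgt ja => /(_ _)/negP[]//; apply/orP; right.
    by apply/existsP; exists (Ordinal ij).
  - move=> altN; case/orP: sa => [/eqP aN|/existsP[i Ei]].
      by rewrite aN ltnn in altN.
    by exists (val i) => //; exact: ltn_ord.
have indep_a i j : a <= i -> i < j < N -> ~~ E i j.
  move=> ai /andP[ij jN]; apply/negP => Eij.
  have [|i0 i0a /negP] := stop_a; first by lia.
  (* Compression lowers [i] to [a] and then [j] to [i0], which would make [i0] adjacent to [a]. *)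
  apply; have Eaj : E a j.
    by have [->//|ai'] := eqVneq a i; apply: (compE i) => //; lia.
  by rewrite symE in Eaj; apply: (compE j) => //; lia.
(* Tail vertices are numbered from the last one backwards, which makes the count of missed clique
   vertices nonincreasing. *)
pose f c := \sum_(0 <= i < a) ~~ E i (N - c.+1).
exists a, f; split => //.
- move=> i j /andP[ij jb]; rewrite /f big_nat [leqRHS]big_nat; apply: leq_sum => h ha.
  have [->//|ij'] := eqVneq i j.
  have [Ei|_] := boolP (E h (N - i.+1)); last exact: leq_b1.
  suff -> : E h (N - j.+1) by [].
  by rewrite symE; rewrite symE in Ei; apply: (compE (N - i.+1)) => //; lia.
- by move=> j _; apply: leq_trans (sum_nat_bool_leq _ _ _) _; rewrite subn0.
- move=> m; rewrite (big_cat_nat (leq0n a) aN)/= mulnDr leq_add//.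
    apply: leq_trans (sum_exp_leq m a); rewrite leq_mul2l; apply/orP; right.
    apply: leq_sum => j _; case: m => // m.
    by rewrite leq_exp2r// -[leqRHS]subn0 sum_nat_bool_leq.
  rewrite sum_nat_reflect// leq_mul2l; apply/orP; right.
  rewrite big_nat [leqRHS]big_nat; apply: leq_sum => c /andP[_ cb].
  case: m => // m; rewrite leq_exp2r// (@big_cat_nat _ _ _ a)//=; last by lia.
  rewrite [X in _ + X]big1_seq => [|i /andP[_]]; last first.
    by rewrite mem_index_iota => iac; rewrite (negbTE (indep_a _ _ _ _))//; lia.
  rewrite addn0 -(leq_add2r (f c)) subnK; last first.
    by apply: leq_trans (sum_nat_bool_leq _ _ _) _; rewrite subn0.
  rewrite /f -big_split /= (eq_bigr (fun=> 1)) => [|i _]; last by case: (E i _).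
  by rewrite sum_nat_const_nat muln1 subn0.
- move=> l l0; rewrite (big_cat_nat (leq0n a) aN)/= addnC mulnDr leq_add//.
    apply: leq_trans (sum_exp_leq l _); rewrite leq_mul2l; apply/orP; right.
    rewrite sum_nat_reflect// big_nat [leqRHS]big_nat; apply: leq_sum => c /andP[_ cb].
    rewrite leq_exp2r//; apply: leq_trans (sum_nat_bool_leq _ _ _) _; lia.
  rewrite leq_mul2l; apply/orP; right.
  (* All later nonneighbours of a clique vertex lie in the tail. Giving each tail position its
     increment and summing over the clique vertices collects every increment [f c] times. *)
  have step i : i < a -> (\sum_(i.+1 <= k < N) ~~ E i k) ^ l <=
      \sum_(0 <= c < N - a) ~~ E i (N - c.+1) * (c.+1 ^ l - c ^ l).
    move=> ia; rewrite (@big_cat_nat _ _ _ a)//= big1_seq => [|k /andP[_]]; last first.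
      by rewrite mem_index_iota => /andP[ik ka]; rewrite clique_a// ik.
    by rewrite add0n sum_nat_reflect// leq_exp_sum_steps.
  apply: (@leq_trans (\sum_(0 <= i < a) \sum_(0 <= c < N - a)
      ~~ E i (N - c.+1) * (c.+1 ^ l - c ^ l))).
    by rewrite big_nat [leqRHS]big_nat; apply: leq_sum => i /andP[_ /step].
  rewrite exchange_big_nat/=; apply: leq_sum => c _; by rewrite -big_distrl.
Qed.

Lemma card_ord_sum (n : nat) (P : pred 'I_n.+1) :
  #|[set i | P i]%SET| = \sum_(0 <= i < n.+1) P (inord i).
Proof.
rewrite -sum1_card big_mkcond big_mkord /=; apply: eq_bigr => i _.
by rewrite inE inord_val; case: (P i).
Qed.

(** Cliques are counted at their last vertex and independent sets at their first, hence the reversed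
    rank [n - i]; this matches the two sums of [compressed_staircase]. *)
Lemma compressed_counts (n l m : nat) (e : rel 'I_n.+1) : symmetric e ->
  let E i j := e (inord i) (inord j) in
  m.+1`! * #|cliques e m.+1| <=
     m.+1 * (\sum_(0 <= j < n.+1) (\sum_(0 <= i < j) E i j) ^ m) /\
  l.+1`! * #|cliques (fun x y => ~~ e x y) l.+1| <=
     l.+1 * (\sum_(0 <= i < n.+1) (\sum_(i.+1 <= k < n.+1) ~~ E i k) ^ l).
Proof.
move=> symm_e E; split; rewrite factS -mulnA leq_mul2l; apply/orP; right.
  have last := leq_card_cliques_last e (@nat_of_ord _) m (@ord_inj _) symm_e.
  apply: leq_trans (leq_mul (leqnn _) last) _.
  rewrite big_distrr big_mkord /=; apply: leq_sum => j _.
  apply: leq_trans (fact_bin_leq_exp _ _) _.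
  rewrite card_ord_sum (@big_cat_nat _ _ _ j)//=; last by rewrite ltnW.
  rewrite [X in _ + X]big1_seq => [|i /andP[_]]; last first.
    by rewrite mem_index_iota => /andP[ji iN]; rewrite inordK// ltnNge ji.
  rewrite addn0 leq_eqVlt; apply/orP; left; apply/eqP; congr (_ ^ _).
  apply: eq_big_nat => i /andP[_ ij].
  by rewrite inordK ?ij /E ?inord_val//; exact: ltn_trans (ltn_ord j).
have rk_inj : injective (fun i : 'I_n.+1 => n - i).
  by move=> i j /= ij; apply: val_inj => /=; have := ltn_ord i; have := ltn_ord j; lia.
have symm_ne : symmetric (fun x y => ~~ e x y) by move=> x y; rewrite symm_e.
apply: leq_trans (leq_mul (leqnn _) (leq_card_cliques_last _ _ l rk_inj symm_ne)) _.
rewrite big_distrr big_mkord /=; apply: leq_sum => i _.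
apply: leq_trans (fact_bin_leq_exp _ _) _.
rewrite card_ord_sum (@big_cat_nat _ _ _ i.+1)//=.
rewrite big1_seq => [|k /andP[_]]; last first.
  by rewrite mem_index_iota => ki; rewrite inordK; have := ltn_ord i; case: ltnP => //; lia.
rewrite add0n leq_eqVlt; apply/orP; left; apply/eqP; congr (_ ^ _).
apply: eq_big_nat => k /andP[ik kN].
by rewrite inordK// /E inord_val symm_e; case: ltnP => //; have := ltn_ord i; lia.
Qed.

(** * The extremal graphs *)

Lemma adj_Q n t (x y : 'I_n) : adj (Q n t) x y = [&& x != y, x < t & y < t].
Proof.
rewrite adj_graph_of; congr (_ && _); apply/fintype.subsetP/andP => [h|[xt yt] z].
  by split; [have := h x|have := h y]; rewrite !inE eqxx ?orbT => /(_ isT).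
by rewrite !inE => /orP[] /eqP ->.
Qed.

Lemma adj_Qbar n t (x y : 'I_n) : x != y -> adj (Qbar n t) x y = ~~ adj (Q n t) x y.
Proof. by move=> xy; rewrite adj_graph_of xy. Qed.

Lemma card_ltn_ord n t : t <= n -> #|[set i : 'I_n | i < t]%SET| = t.
Proof.
move=> tn; have w_inj : injective (widen_ord tn).
  by move=> i j /(congr1 val) ij; apply: val_inj.
rewrite -[RHS]card_ord -cardsT -(card_imset _ w_inj); congr #|pred_of_set _|.
apply/setP => i; rewrite inE; apply/idP/imsetP => [it|[j _ ->]]; last exact: (ltn_ord j).
by exists (Ordinal it); rewrite ?inE//; apply: val_inj.
Qed.

Lemma leq_bin_cliques_Q n t k : t <= n -> 'C(t, k) <= #|cliques (adj (Q n t)) k|.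
Proof.
move=> tn; rewrite -{1}(card_ltn_ord n t tn) -cards_draws.
apply/subset_leq_card/fintype.subsetP => X; rewrite inE => /andP[/fintype.subsetP XT /eqP Xk].
apply/cliquesP; split=> // x y /XT + /XT; rewrite !inE adj_Q => -> -> ->.
by [].
Qed.

(** The two terms count the independent sets that avoid the clique and those with one vertex in
    it. *)
Lemma leq_bin_indep_Q n t k : t <= n ->
  'C(n - t, k.+1) + t * 'C(n - t, k) <= #|cliques (fun x y => ~~ adj (Q n t) x y) k.+1|.
Proof.
move=> tn; set T := [set i : 'I_n | i < t]%SET.
have cT : #|T| = t by exact: card_ltn_ord.
have cTC : #|~: T| = n - t by rewrite cardsCs finset.setCK card_ord cT.
pose draws h := [set X : {set 'I_n} | (X \subset ~: T) && (#|X| == h)]%SET.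
have cdraws h : #|draws h| = 'C(n - t, h) by rewrite cards_draws cTC.
pose add (p : 'I_n * {set 'I_n}) := (p.1 |: p.2)%SET.
have inTC X h x : X \in draws h -> x \in X -> x \notin T.
  by rewrite inE => /andP[/fintype.subsetP XT _] /XT; rewrite inE.
have add_inj : {in finset.setX T (draws k) &, injective add}.
  move=> [x X] [y Y]; rewrite !inE /= => /andP[xT Xd] /andP[yT Yd] XY.
  have XdE : X \in draws k by rewrite inE.
  have YdE : Y \in draws k by rewrite inE.
  have xX : x \notin X by apply/negP => /(inTC _ _ _ XdE); rewrite inE xT.
  have yY : y \notin Y by apply/negP => /(inTC _ _ _ YdE); rewrite inE yT.
  have xy : x = y.
    have : x \in add (y, Y) by rewrite -XY /add setU11.
    by rewrite /add /= in_setU1 => /orP[/eqP//|/(inTC _ _ _ YdE)]; rewrite inE xT.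
  congr (_, _) => //; move: XY; rewrite /add /= -xy => /(congr1 (fun Z => Z :\ x)%SET).
  by rewrite !setU1K// xy.
have disj : [disjoint draws k.+1 & add @: finset.setX T (draws k)]%SET.
  apply/pred0P => X /=; apply/negP => /andP[Xd /imsetP[[x Y]]].
  rewrite finset.in_setX /= => /andP[xT _] XE; have := inTC _ _ x Xd.
  by rewrite XE /add setU11 xT => /(_ isT).
have -> : t * 'C(n - t, k) = #|finset.setX T (draws k)| by rewrite cardsX cdraws cT.
rewrite -cdraws -(card_in_imset add_inj).
have /eqP <- : #|draws k.+1 :|: add @: finset.setX T (draws k)|%SET ==
    #|draws k.+1| + #|add @: finset.setX T (draws k)|%SET.
  by rewrite (leq_card_setU _ _).2.
have nadj x y : y \notin T -> ~~ adj (Q n t) x y.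
  by rewrite adj_Q inE => /negbTE ->; rewrite !andbF.
apply/subset_leq_card/fintype.subsetP => X /finset.setUP[Xd|/imsetP[[x Y]]].
  have := Xd; rewrite inE => /andP[_ /eqP Xk].
  by apply/cliquesP; split=> // x y xX yX xy; exact/nadj/(inTC _ _ _ Xd).
rewrite finset.in_setX /= => /andP[xT Yd] ->; have := Yd; rewrite inE => /andP[_ /eqP Yk].
have xY : x \notin Y by apply/negP => /(inTC _ _ _ Yd); rewrite xT.
apply/cliquesP; split; first by rewrite /add /= cardsU1 xY Yk.
move=> y z; rewrite /add /= !in_setU1.
case/orP => [/eqP ->|yY]; case/orP => [/eqP ->|zY]; rewrite ?eqxx// => yz.
- exact/nadj/(inTC _ _ _ Yd).
- by rewrite adj_sym; exact/nadj/(inTC _ _ _ Yd).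
- exact/nadj/(inTC _ _ _ Yd).
Qed.

Lemma exp_sub_leq_ffact t k : (t - k) ^ k <= t ^_ k.
Proof.
elim: k t => // k IH t; rewrite ffactnS expnS leq_mul ?leq_subr//.
by apply: leq_trans (IH t.-1); case: k {IH} => // k; rewrite leq_exp2r//; lia.
Qed.

Local Open Scope classical_set_scope.
Local Open Scope ring_scope.

(** * Three-block graphs *)

Lemma ge0_is_derive_le {R : realType} (f df : R -> R) (a b : R) : a <= b ->
  (forall x, a <= x <= b -> is_derive x 1 f (df x)) ->
  (forall x, a <= x <= b -> 0 <= df x) -> f a <= f b.
Proof.
move=> ab fd df0.
have [||c] := @MVT_segment R f df a b ab.
- by move=> x /subset_itv_oo_cc; rewrite in_itv/= => /fd.
- apply: derivable_within_continuous => x; rewrite in_itv/= => /fd h.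
  exact: ex_derive.
- rewrite in_itv/= => cab fE; rewrite -subr_ge0 fE mulr_ge0 ?subr_ge0 ?df0//.
Qed.

Lemma le0_is_derive_ge {R : realType} (f df : R -> R) (a b : R) : a <= b ->
  (forall x, a <= x <= b -> is_derive x 1 f (df x)) ->
  (forall x, a <= x <= b -> df x <= 0) -> f b <= f a.
Proof.
move=> ab fd df0; rewrite -lerN2.
apply: (@ge0_is_derive_le R (- f) (- df)) => // x xab.
  exact: is_deriveN (fd x xab).
by rewrite fctE oppr_ge0 df0.
Qed.

Lemma exp_le {R : realType} (n : nat) (x y : R) : 0 <= x -> x <= y -> x ^+ n <= y ^+ n.
Proof. by move=> x0 xy; apply: lerXn2r; rewrite ?nnegrE// (le_trans x0). Qed.

(** With [l] and [m] for r - 1 and s - 1, this expression gives its sign both to the derivative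
    along three-block graphs and to that of [tail_ratio]. *)
Definition tangent_excess {R : realType} (l m : nat) (x z : R) : R :=
  x ^+ m - (x + z) ^+ m + m%:R * l%:R * z * x ^+ m.-1.

Lemma tangent_excessE {R : realType} l m (x z : R) : tangent_excess l m x z =
  z * (m%:R * l%:R * x ^+ m.-1 - \sum_(i < m) (x + z) ^+ (m.-1 - i) * x ^+ i).
Proof.
rewrite /tangent_excess -opprB subrXX addrAC subrr add0r; ring.
Qed.

(** The chord slope of the [m]-th power over [x, x + z], divided by [x ^+ m.-1], depends only on z/x
    and grows with it. Cross-multiplication admits [x = 0]. *)
Lemma chord_cross {R : realType} m (x z x' z' : R) : 0 <= x -> 0 <= z ->
  0 <= x' -> 0 <= z' -> z * x' <= z' * x ->
  x' ^+ m.-1 * (\sum_(i < m) (x + z) ^+ (m.-1 - i) * x ^+ i) <=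
  x ^+ m.-1 * (\sum_(i < m) (x' + z') ^+ (m.-1 - i) * x' ^+ i).
Proof.
move=> x0 z0 x'0 z'0 h; rewrite !mulr_sumr; apply: ler_sum => i _.
have im : (i <= m.-1)%N by case: m i => [[]//|m i]; rewrite -ltnS ltn_ord.
have split_exp (c : R) : c ^+ m.-1 = c ^+ (m.-1 - i) * c ^+ i.
  by rewrite -exprD subnK.
rewrite (split_exp x) (split_exp x') [leLHS]mulrACA [leRHS]mulrACA.
rewrite -[x' ^+ (_ - _) * _]exprMn -[x ^+ (_ - _) * _]exprMn [x ^+ i * _]mulrC.
apply: ler_wpM2r; first by rewrite mulr_ge0 ?exprn_ge0.
by apply: lerXn2r; rewrite ?nnegrE ?mulr_ge0 ?addr_ge0// !mulrDr; lra.
Qed.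

(** By [tangent_excessE] the sign compares the chord slope with a multiple of [x ^+ m.-1], so
    nonnegativity persists when z/x falls. *)
Lemma tangent_excess_ge0 {R : realType} l m (x z x' z' : R) : 0 < x -> 0 < z ->
  0 <= x' -> 0 <= z' -> z' * x <= z * x' ->
  0 <= tangent_excess l m x z -> 0 <= tangent_excess l m x' z'.
Proof.
move=> x0 z0 x'0 z'0 h; rewrite !tangent_excessE pmulr_rge0// => e0.
rewrite mulr_ge0//; have := chord_cross m _ _ _ _ x'0 z'0 (ltW x0) (ltW z0) h.
move: e0; rewrite !subr_ge0 => /(ler_wpM2l (exprn_ge0 m.-1 x'0)).
move=> + h2; move/(le_trans h2).
rewrite (_ : x' ^+ _ * _ = x ^+ m.-1 * (m%:R * l%:R * x' ^+ m.-1)).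
  by rewrite ler_pM2l ?exprn_gt0.
by rewrite [LHS]mulrC -[LHS]mulrA [LHS]mulrCA.
Qed.

(** The contrapositive of the preceding lemma, extended to [x' = 0] and [z' = 0], since curves may
    end there. *)
Lemma tangent_excess_lt0 {R : realType} l m (x z x' z' : R) : (0 < l)%N -> (0 < m)%N ->
  0 <= x -> 0 <= z -> 0 <= x' -> 0 <= z' -> z * x' <= z' * x ->
  tangent_excess l m x z < 0 -> tangent_excess l m x' z' <= 0.
Proof.
move=> l0 m0 x0 z0 x'0 z'0 h e0; rewrite leNgt; apply/negP => e'0.
move: x'0 z'0 e'0; rewrite !le_eqVlt => /predU1P[<-|x'0] /predU1P[<-|z'0] e'0.
- by rewrite tangent_excessE mul0r ltxx in e'0.
(* For [m = 1] the excess is (l - 1)z, which is never negative. For larger [m] its value at [x' = 0]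
   is [- z' ^+ m]. *)
- have [m1|m1] := eqVneq m 1%N.
    move: e0 e'0; rewrite m1 /tangent_excess !expr1 !expr0.
    have : (1 : R) <= l%:R by rewrite ler1n.
    by nra.
  have [E1 E2] : (0 : R) ^+ m = 0 /\ (0 : R) ^+ m.-1 = 0.
    by case: m m0 m1 {e0 e'0} => [|[|m]]//= _ _; rewrite !expr0n.
  move: e'0; rewrite /tangent_excess add0r E1 E2 mulr0 addr0 sub0r oppr_gt0.
  by rewrite ltNge exprn_ge0// ltW.
- by rewrite tangent_excessE mul0r ltxx in e'0.
- by move: e0; rewrite ltNge (tangent_excess_ge0 l m x' z')// ltW.
Qed.

(* [is_derive] is a type class, and instance search on the pointwise forms
   below diverges; this copy is invisible to it. *)
Definition has_deriv {R : realType} (f : R -> R) (x df : R) : Prop :=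
  is_derive x 1 f df.

Lemma has_deriv_eq {R : realType} (f : R -> R) (x df df' : R) :
  has_deriv f x df' -> df' = df -> has_deriv f x df.
Proof. by move=> ? <-. Qed.

Lemma has_derivD {R : realType} (f g : R -> R) (x df dg : R) :
  has_deriv f x df -> has_deriv g x dg ->
  has_deriv (fun y => f y + g y) x (df + dg).
Proof. exact: is_deriveD. Qed.

Lemma has_derivN {R : realType} (f : R -> R) (x df : R) : has_deriv f x df ->
  has_deriv (fun y => - f y) x (- df).
Proof. exact: is_deriveN. Qed.

Lemma has_derivM {R : realType} (f g : R -> R) (x df dg : R) :
  has_deriv f x df -> has_deriv g x dg ->
  has_deriv (fun y => f y * g y) x (f x * dg + g x * df).
Proof. exact: is_deriveM. Qed.

Lemma has_derivX {R : realType} (f : R -> R) n (x df : R) : has_deriv f x df ->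
  has_deriv (fun y => f y ^+ n) x (n%:R * f x ^+ n.-1 * df).
Proof.
move=> fx; rewrite (_ : (fun y => f y ^+ n) = f ^+ n); first exact: is_deriveX.
by apply/funext => y; rewrite exprfctE.
Qed.

Lemma has_derivV {R : realType} (f : R -> R) (x df : R) : f x != 0 -> has_deriv f x df ->
  has_deriv (fun y => (f y)^-1) x (- (f x) ^- 2 * df).
Proof. exact: is_deriveV. Qed.

Lemma has_derivid {R : realType} (x : R) : has_deriv (fun y => y) x 1.
Proof. exact: is_derive_id. Qed.

Lemma has_derivcst {R : realType} (c x : R) : has_deriv (fun _ => c) x 0.
Proof. exact: is_derive_cst. Qed.

(** Computes a derivative by structural rules and leaves its identification with the expected one as
    an equation, next to any side conditions. *)
Ltac differentiate :=
  apply: has_deriv_eq;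
  [repeat lazymatch goal with
   | |- has_deriv (fun y => y) _ _ => exact: has_derivid
   | |- has_deriv (fun _ => ?c) _ _ => exact: has_derivcst
   | |- has_deriv (fun y => _ + _) _ _ => apply: has_derivD
   | |- has_deriv ( *%R ?c) _ _ =>
       exact: (has_derivM _ _ _ _ _ (has_derivcst c _) (has_derivid _))
   | |- has_deriv GRing.inv _ _ => apply: (has_derivV _ _ _ _ (has_derivid _))
   | |- has_deriv -%R _ _ => exact: (has_derivN _ _ _ (has_derivid _))
   | |- has_deriv (fun y => - _) _ _ => apply: has_derivN
   | |- has_deriv (fun y => _ * _) _ _ => apply: has_derivM
   | |- has_deriv (fun y => _ ^+ _) _ _ => apply: has_derivX
   | |- has_deriv (fun y => _^-1) _ _ => apply: has_derivV
   end|rewrite ?/id; cbv beta].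

(** * Roots, the limit density [psi] and the region below the two extremal curves *)

Lemma powR_invn_exp {R : realType} (n : nat) (x : R) : (0 < n)%N -> 0 <= x ->
  (x `^ n%:R^-1) ^+ n = x.
Proof.
move=> n0 x0; rewrite -powR_mulrn ?powR_ge0// -powRrM mulVf ?powRr1//.
by rewrite pnatr_eq0 -lt0n.
Qed.

Lemma exists_root {R : realType} (n : nat) (x : R) : (0 < n)%N -> 0 <= x ->
  exists2 y : R, 0 <= y & y ^+ n = x.
Proof.
by move=> n0 x0; exists (x `^ n%:R^-1); [exact: powR_ge0|exact: powR_invn_exp].
Qed.

(** The limit density of [k]-sets with at most one vertex outside a part of proportion [y];
    unrelated to the staircase heights psi_j of the overview. *)
Definition psi {R : realType} (k : nat) (y : R) : R :=
  y ^+ k + k%:R * y ^+ k.-1 * (1 - y).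

Lemma psi_has_deriv {R : realType} k (y : R) : (1 < k)%N ->
  has_deriv (psi k) y (k%:R * k.-1%:R * y ^+ k.-2 * (1 - y)).
Proof.
case: k => [|[|k]]// _; rewrite /psi.
differentiate.
rewrite /= exprS; ring.
Qed.

Lemma psi_continuous {R : realType} k : continuous (@psi R k).
Proof.
move=> y; rewrite /psi; apply: cvgD; first exact: exprn_continuous.
apply: cvgM; last by apply: cvgB; [exact: cvg_cst|exact: cvg_id].
by apply: cvgM; [exact: cvg_cst|exact: exprn_continuous].
Qed.

Lemma psi0 {R : realType} k : (1 < k)%N -> psi k (0 : R) = 0.
Proof. by case: k => [|[|k]]// _; rewrite /psi !expr0n/= mulr0 mul0r addr0. Qed.

Lemma psi1 {R : realType} k : psi k (1 : R) = 1.
Proof. by rewrite /psi subrr mulr0 addr0 expr1n. Qed.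

Lemma psi_lt {R : realType} k (x y : R) : (1 < k)%N -> 0 <= x -> x < y -> y <= 1 ->
  psi k x < psi k y.
Proof.
move=> k1 x0 xy y1.
have [|c] := @MVT R (psi k) _ x y xy (fun z _ => psi_has_deriv k z k1).
  exact/continuous_subspaceT/psi_continuous.
rewrite in_itv/= => /andP[xc cy] E; rewrite -subr_gt0 E.
have c0 : 0 < c := le_lt_trans x0 xc.
have c1 : c < 1 := lt_le_trans cy y1.
rewrite !mulr_gt0 ?subr_gt0 ?exprn_gt0 ?ltr0n ?(ltnW k1)//.
by rewrite -subn1 subn_gt0.
Qed.

Lemma psi_le {R : realType} k (x y : R) : (1 < k)%N -> 0 <= x -> x <= y -> y <= 1 ->
  psi k x <= psi k y.
Proof.
move=> k1 x0; rewrite le_eqVlt => /predU1P[->//|xy] y1.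
exact/ltW/psi_lt.
Qed.

Lemma psi_solve {R : realType} k (b p : R) : (1 < k)%N -> 0 <= b ->
  0 <= p <= psi k b -> exists2 q, 0 <= q <= b & psi k q = p.
Proof.
move=> k1 b0 pb; have [||q] := @IVT R (psi k) 0 b p b0.
- exact/continuous_subspaceT/psi_continuous.
- case/andP: pb => p0 pb.
  by rewrite psi0// ge_min p0 le_max pb orbT.
by rewrite in_itv; exists q.
Qed.

(* The pairs (independent density, clique density) lying below one of the two
   curves traced out by the limits of the extremal graphs. *)
Definition region {R : realType} (r s : nat) (I K : R) : Prop :=
  exists2 y : R, 0 <= y <= 1 &
    (I <= y ^+ r /\ K <= psi s (1 - y)) \/ (I <= psi r y /\ K <= (1 - y) ^+ s).

Lemma region_sym {R : realType} r s (I K : R) : region r s I K -> region s r K I.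
Proof.
case=> y y01 h; exists (1 - y); first lra.
by rewrite subKr; case: h => -[]; [right|left].
Qed.

(* [three_x l I t] and [three_z l I t] are the sizes that, together with [t],
   sum to 1 and satisfy [t ^+ l.+1 + l.+1%:R * t ^+ l * three_z l I t = I]. *)
Definition three_z {R : realType} (l : nat) (I t : R) : R :=
  l.+1%:R^-1 * (I * (t ^+ l)^-1 - t).

Definition three_x {R : realType} (l : nat) (I t : R) : R := 1 - t - three_z l I t.

Lemma three_x_has_deriv {R : realType} l (I t : R) : 0 < t ->
  has_deriv (three_x l I) t (l%:R * three_z l I t / t).
Proof.
move=> t0; have tl : t ^+ l != 0 by rewrite gt_eqF ?exprn_gt0.
have t_neq0 : t != 0 by rewrite gt_eqF.
rewrite /three_x /three_z; differentiate; first by [].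
case: l tl => [_|k tl].
  by rewrite /= !expr0 invr1; field.
have tk : t ^+ k != 0 by rewrite gt_eqF ?exprn_gt0.
rewrite /= !exprS -[k.+2%:R]natr1; field.
by rewrite tk t_neq0 nat1r natr1 pnatr_eq0.
Qed.

Lemma three_z_ge0 {R : realType} l (I t : R) : 0 < t -> t ^+ l.+1 <= I ->
  0 <= three_z l I t.
Proof.
move=> t0 tI; rewrite /three_z mulr_ge0// subr_ge0 ler_pdivlMr ?exprn_gt0//.
by rewrite -exprS.
Qed.

Lemma three_xDz {R : realType} l (I t : R) : three_x l I t + three_z l I t = 1 - t.
Proof. by rewrite /three_x subrK. Qed.

Lemma three_zE {R : realType} l (I t z : R) : 0 < t ->
  t ^+ l.+1 + l.+1%:R * t ^+ l * z = I -> three_z l I t = z.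
Proof.
move=> t0 <-; have tl : t ^+ l != 0 by rewrite gt_eqF ?exprn_gt0.
have l1 : l.+1%:R != 0 :> R by rewrite pnatr_eq0.
rewrite /three_z exprS -[l.+1%:R]natr1 in l1 *; field.
by rewrite tl l1.
Qed.

(** The bound on [b] keeps [three_z] nonnegative on [a, b], hence also the derivative of [three_x].
    As the two sum to 1 - t, their ratio z/x falls along the curve. *)
Lemma three_x_le {R : realType} l (I a b : R) : 0 < a -> a <= b -> b ^+ l.+1 <= I ->
  three_x l I a <= three_x l I b.
Proof.
move=> a0 ab bI.
apply: (ge0_is_derive_le _ (fun t => l%:R * three_z l I t / t) _ _ ab) => t /andP[at_ tb];
  have t0 : 0 < t := lt_le_trans a0 at_; first exact: three_x_has_deriv.
rewrite mulr_ge0 ?invr_ge0 ?(ltW t0)// mulr_ge0// three_z_ge0// (le_trans _ bI)//.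
by rewrite exp_le// ltW.
Qed.

Lemma three_blocks_has_deriv {R : realType} l m (I t : R) : (0 < m)%N -> 0 < t ->
  has_deriv (fun t => (1 - t) ^+ m.+1 + m.+1%:R * t * three_x l I t ^+ m) t
    (m.+1%:R * tangent_excess l m (three_x l I t) (three_z l I t)).
Proof.
move=> m0 t0; differentiate; first exact: three_x_has_deriv.
rewrite /tangent_excess three_xDz /=.
case: m m0 => // k _; rewrite /= exprS; field.
by rewrite gt_eqF.
Qed.

(** Here x and z form one clique, and the independent block b is joined to x only. After the cases
    with an empty block, the independent density is held fixed and the size of b varied. *)
Lemma region_three_blocks {R : realType} l m (x b z : R) : (0 < l)%N -> (0 < m)%N ->
  0 <= x -> 0 <= b -> 0 <= z -> x + b + z = 1 ->
  region l.+1 m.+1 (b ^+ l.+1 + l.+1%:R * b ^+ l * z)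
                   ((1 - b) ^+ m.+1 + m.+1%:R * b * x ^+ m).
Proof.
move=> l0 m0; have psi_expr0 k : (0 < k)%N -> (0 : R) ^+ k = 0.
  by rewrite expr0n; case: k.
rewrite le_eqVlt => /predU1P[<-|x0] b0 z0 xbz.
  exists b; first lra.
  right; split; last by rewrite psi_expr0// mulr0 addr0.
  by rewrite /psi/= (_ : 1 - b = z)//; lra.
move: b0; rewrite le_eqVlt => /predU1P[b0|b0].
  exists 0; first by rewrite lexx ler01.
  by right; rewrite psi0// -b0 !psi_expr0// !(mulr0, mul0r, addr0) subr0.
move: z0; rewrite le_eqVlt => /predU1P[z0|z0].
  exists b; first lra.
  left; rewrite -z0 mulr0 addr0; split=> //.
  have -> : 1 - b = x by lra.
  by rewrite /psi/= (_ : 1 - x = b); [rewrite mulrAC|lra].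
set I := _ + _ * z.
have zE : three_z l I b = z by exact: three_zE.
have xE : three_x l I b = x by have := three_xDz l I b; rewrite zE; lra.
have bI : b ^+ l.+1 <= I by rewrite lerDl !mulr_ge0 ?exprn_ge0 ?ltW.
have I0 : 0 < I by rewrite (lt_le_trans _ bI) ?exprn_gt0.
rewrite -xE; set F := fun t => (1 - t) ^+ m.+1 + m.+1%:R * t * three_x l I t ^+ m.
rewrite -/(F b).
(* If the derivative is nonnegative at [b], it stays so as b grows; the curve is followed up to [c],
   where the block z vanishes. *)
have [D0|D0] := leP 0 (tangent_excess l m x z).
  have [c c0 cI] := exists_root l.+1 I isT (ltW I0).
  have bc : b <= c by rewrite -(ler_pXn2r (ltn0Sn l)) ?nnegrE ?cI//; exact: ltW.
  have zc : three_z l I c = 0.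
    by apply: three_zE; [exact: lt_le_trans bc|rewrite mulr0 addr0].
  have xc := three_x_le l I b c b0 bc; rewrite cI lexx xE in xc.
  have {}xc := xc isT.
  have xcE : three_x l I c = 1 - c by rewrite -(three_xDz l I c) zc addr0.
  have FE : F c = psi m.+1 (1 - c).
    by rewrite /F /psi/= xcE subKr -!mulrA (mulrC c).
  exists c; first by rewrite c0; move: xc; rewrite xcE; lra.
  left; rewrite cI; split=> //; rewrite -FE.
  apply: (ge0_is_derive_le F _ _ _ bc) => t /andP[bt tc];
    have t0 : 0 < t := lt_le_trans b0 bt.
    exact: three_blocks_has_deriv.
  rewrite mulr_ge0//.
  have tI : t ^+ l.+1 <= I by rewrite -cI exp_le// ltW.
  have xt : x <= three_x l I t by rewrite -xE; exact: three_x_le.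
  have zt := three_z_ge0 l I t t0 tI; have xzt := three_xDz l I t.
  apply: (tangent_excess_ge0 l m x z) => //; first exact: le_trans (ltW x0) xt.
  by apply: ler_pM => //; [exact: ltW|lra].
(* Otherwise the objective improves as b shrinks, down to [q], where the block x vanishes. *)
have [//||q /andP[q0 qb] qI] := @psi_solve R l.+1 b I _ (ltW b0).
  rewrite (ltW I0)/= /psi/= lerD2l ler_wpM2l ?mulr_ge0 ?exprn_ge0 ?ltW//.
  by lra.
have {}q0 : 0 < q.
  rewrite lt_neqAle q0 andbT; apply/eqP => q0'.
  by move: qI; rewrite -q0' psi0// => I0'; rewrite -I0' ltxx in I0.
have zq : three_z l I q = 1 - q by apply: three_zE.
have xq : three_x l I q = 0 by have := three_xDz l I q; rewrite zq; lra.
exists q; first lra.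
right; rewrite qI; split=> //.
rewrite (_ : (1 - q) ^+ m.+1 = F q); last by rewrite /F xq psi_expr0// mulr0 addr0.
apply: (le0_is_derive_ge F _ _ _ qb) => t /andP[qt tb];
  have t0 : 0 < t := lt_le_trans q0 qt; first exact: three_blocks_has_deriv.
rewrite mulr_ge0_le0//.
have bt : t ^+ l.+1 <= b ^+ l.+1 by rewrite exp_le// ltW.
have tI : t ^+ l.+1 <= I := le_trans bt bI.
have xt : 0 <= three_x l I t by rewrite -xq; exact: three_x_le.
have xt' : three_x l I t <= x by rewrite -xE; exact: three_x_le.
have zt := three_z_ge0 l I t t0 tI; have xzt := three_xDz l I t.
apply: (tangent_excess_lt0 l m x z) => //; rewrite ?(ltW x0) ?(ltW z0)//.
rewrite mulrC [leRHS]mulrC; apply: ler_pM => //; [exact: ltW|lra].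
Qed.

(** * Staircases *)

Lemma region_le {R : realType} r s (I I' K K' : R) : I' <= I -> K' <= K ->
  region r s I K -> region r s I' K'.
Proof.
move=> II KK [y y01 h]; exists y => //.
by case: h => -[h1 h2]; [left|right]; split; lra.
Qed.

Lemma exp_slope_le {R : realType} (n : nat) (c x y : R) : 0 <= c -> 0 <= x -> x <= y ->
  \sum_(i < n) c ^+ (n.-1 - i) * x ^+ i <= \sum_(i < n) c ^+ (n.-1 - i) * y ^+ i.
Proof.
move=> c0 x0 xy; apply: ler_sum => i _; apply: ler_wpM2l; first exact: exprn_ge0.
exact: exp_le.
Qed.

(** The map from z to a^m - (a - z)^m is concave and vanishes at 0, so its quotient by z does not
    increase. *)
Lemma tail_excess_concave {R : realType} (m : nat) (a z z0 : R) :
  0 <= z -> z <= z0 -> z0 <= a ->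
  z * (a ^+ m - (a - z0) ^+ m) <= z0 * (a ^+ m - (a - z) ^+ m).
Proof.
move=> zge0 zz0 z0a; rewrite !subrXX.
have -> : a - (a - z0) = z0 by lra.
have -> : a - (a - z) = z by lra.
rewrite mulrCA ler_wpM2l//; first lra.
by rewrite ler_wpM2l//; apply: exp_slope_le; lra.
Qed.

Definition tail_ratio {R : realType} (l m : nat) (a t : R) : R :=
  (a ^+ m - (a - t ^+ l) ^+ m) * t^-1.

(** The derivative has the sign of the tangent excess at (a - t^l, t^l). The ratio of these sizes
    makes it change at most once, from positive to negative. *)
Lemma tail_ratio_quasiconcave {R : realType} (l m : nat) (a u0 u v : R) :
  (0 < l)%N -> (0 < m)%N -> 0 < u0 -> u0 <= u -> u <= v -> v ^+ l = a ->
  Num.min (tail_ratio l m a u0) (tail_ratio l m a v) <= tail_ratio l m a u.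
Proof.
move=> l0 m0 u00 u0u uv va; set F := tail_ratio l m a.
have FD t : 0 < t ->
    has_deriv F t (t ^- 2 * tangent_excess l m (a - t ^+ l) (t ^+ l)).
  move=> t0; have tn0 : t != 0 by rewrite gt_eqF.
  rewrite /F /tail_ratio; differentiate; first by [].
  rewrite /tangent_excess subrK.
  case: l l0 {va F} => // l _; rewrite /= exprS.
  move: (a ^+ m) ((a - t * t ^+ l) ^+ m) (_ ^+ m.-1) => A B C; field.
  exact: tn0.
have [->|uv'] := eqVneq u v; first by rewrite ge_min lexx orbT.
have {uv'} uv' : u < v by rewrite lt_neqAle uv'.
have u_gt0 : 0 < u := lt_le_trans u00 u0u.
have ula : u ^+ l < a.
  rewrite -va ltr_pXn2r// nnegrE ltW//; exact: lt_trans uv'.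
have Il (t : R) : 0 <= t -> 0 <= t ^+ l by move=> ?; exact: exprn_ge0.
have [D0|D0] := leP 0 (tangent_excess l m (a - u ^+ l) (u ^+ l)).
  rewrite ge_min; apply/orP; left.
  apply: (ge0_is_derive_le F _ _ _ u0u) => t /andP[ut tu];
    have t0 : 0 < t := lt_le_trans u00 ut; first exact: FD.
  rewrite mulr_ge0 ?invr_ge0 ?exprn_ge0 ?(ltW t0)//.
  have h := exp_le l t u (ltW t0) tu.
  have := Il t (ltW t0); have := Il u (ltW u_gt0) => u1 t1.
  apply: (tangent_excess_ge0 l m (a - u ^+ l) (u ^+ l)) => //.
  - by rewrite subr_gt0.
  - by rewrite exprn_gt0.
  - lra.
  - by apply: ler_pM => //; lra.
rewrite ge_min; apply/orP; right.
apply: (le0_is_derive_ge F _ _ _ uv) => t /andP[ut tv];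
  have t0 : 0 < t := lt_le_trans u_gt0 ut; first exact: FD.
rewrite mulr_ge0_le0 ?invr_ge0 ?exprn_ge0 ?(ltW t0)//.
have h := exp_le l u t (ltW u_gt0) ut.
have h' := exp_le l t v (ltW t0) tv; rewrite va in h'.
have := Il t (ltW t0); have := Il u (ltW u_gt0) => u1 t1.
apply: (tangent_excess_lt0 l m (a - u ^+ l) (u ^+ l)) => //; try lra.
by apply: ler_pM => //; lra.
Qed.

(** Chebyshev's sum inequality: twice the difference is the double sum of (v_i - v_j)(w_i - w_j),
    whose terms are nonnegative. *)
Lemma chebyshev_sum {R : realType} (k N : nat) (v w : nat -> R) :
  (forall i j, (k <= i <= j)%N -> (j < N)%N -> v i <= v j) ->
  (forall i j, (k <= i <= j)%N -> (j < N)%N -> w i <= w j) ->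
  (\sum_(k <= i < N) v i) * (\sum_(k <= i < N) w i) <=
  (N - k)%:R * \sum_(k <= i < N) v i * w i.
Proof.
move=> vm wm; rewrite -subr_ge0 -(pmulr_rge0 _ (ltr0n R 2)).
have -> : 2%:R * ((N - k)%:R * (\sum_(k <= i < N) v i * w i) -
    (\sum_(k <= i < N) v i) * (\sum_(k <= i < N) w i)) =
  \sum_(k <= i < N) \sum_(k <= j < N) (v i - v j) * (w i - w j).
  have cst (c : R) : \sum_(k <= i < N) c = (N - k)%:R * c.
    by rewrite sumr_const_nat mulr_natl.
  under [RHS]eq_bigr => i _.
    under eq_bigr => j _.
      rewrite (_ : _ * _ = v i * w i + v j * w j - v i * w j - v j * w i); last by ring.
      over.
    rewrite !sumrB big_split/= cst -mulr_sumr -mulr_suml.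
    over.
  rewrite !sumrB big_split/= cst -mulr_sumr -mulr_suml -mulr_sumr; ring.
rewrite big_nat sumr_ge0// => i /andP[ki iN].
rewrite big_nat sumr_ge0// => j /andP[kj jN].
have [ij|/ltnW ji] := leqP i j.
  by rewrite mulr_le0// subr_le0; [apply: vm|apply: wm]; rewrite // ki.
by rewrite mulr_ge0// subr_ge0; [apply: vm|apply: wm]; rewrite // kj.
Qed.

Definition exp_step {R : realType} (l j : nat) : R := j.+1%:R ^+ l - j%:R ^+ l.

Lemma sum_exp_step {R : realType} (l k N : nat) : (k <= N)%N ->
  \sum_(k <= j < N) exp_step l j = N%:R ^+ l - k%:R ^+ l :> R.
Proof. by move=> kN; rewrite (telescope_sumr (fun j => j%:R ^+ l)). Qed.

Lemma exp_increment_le {R : realType} (n : nat) (d x y : R) : 0 <= d -> 0 <= x -> x <= y ->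
  (x + d) ^+ n - x ^+ n <= (y + d) ^+ n - y ^+ n.
Proof.
move=> d0 x0 xy; have y0 := le_trans x0 xy.
rewrite !subrXX (addrC x) (addrC y) !addrK ler_wpM2l//.
apply: ler_sum => i _; apply: ler_pM; rewrite ?exprn_ge0 ?addr_ge0//.
  by apply: exp_le; rewrite ?addr_ge0// lerD2l.
exact: exp_le.
Qed.

Lemma exp_step_le {R : realType} (l i j : nat) : (i <= j)%N ->
  exp_step l i <= exp_step l j :> R.
Proof.
move=> ij; rewrite /exp_step -!natr1.
by apply: exp_increment_le; rewrite ?ler0n ?ler_nat.
Qed.

(** By induction: monotonicity gives k g_k at most the sum so far, and by convexity adding g_k to
    the larger number raises the [l]-th power by more. *)
Lemma hardy_sum {R : realType} (l k : nat) (g : nat -> R) : (0 < l)%N ->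
  (forall i j, (i <= j < k)%N -> g j <= g i) -> (forall j, (j < k)%N -> 0 <= g j) ->
  \sum_(0 <= j < k) g j ^+ l * exp_step l j <= (\sum_(0 <= j < k) g j) ^+ l.
Proof.
move=> l0; elim: k => [_ _|k IH gm g0].
  by rewrite !big_geq// expr0n; case: l l0.
rewrite !big_nat_recr//=.
have {}IH : \sum_(0 <= j < k) g j ^+ l * exp_step l j <= (\sum_(0 <= j < k) g j) ^+ l.
  apply: IH => [i j /andP[ij jk]|j jk]; last by rewrite g0// ltnW.
  by rewrite gm// ij ltnW.
have gk : 0 <= g k by exact: g0.
have kg : k%:R * g k <= \sum_(0 <= j < k) g j.
  rewrite -[k in k%:R]subn0 mulr_natl -sumr_const_nat big_nat [leRHS]big_nat.
  apply: ler_sum => j /andP[_ jk]; apply: gm.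
  by rewrite (ltnW jk) ltnSn.
have := exp_increment_le l _ _ _ gk (mulr_ge0 (ler0n R k) gk) kg.
have -> : (k%:R * g k + g k) ^+ l - (k%:R * g k) ^+ l = g k ^+ l * exp_step l k.
  rewrite -{2}[g k]mul1r -mulrDl natr1 !exprMn /exp_step; ring.
by lra.
Qed.

(** The indices are cut where [g] falls to 1. The Hardy-type bound handles the part before the cut,
    Chebyshev's inequality the part after it. *)
Lemma le_sum_min_exp {R : realType} (l N : nat) (g : nat -> R) : (0 < l)%N ->
  (forall i j, (i <= j < N)%N -> g j <= g i) -> (forall j, (j < N)%N -> 0 <= g j) ->
  N%:R ^+ l <= \sum_(0 <= j < N) g j ^+ l * exp_step l j ->
  N%:R <= \sum_(0 <= j < N) Num.min (g j ^+ l) (g j).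
Proof.
move=> l0 gm g0 gN.
pose cross k := (k == N) || (g k <= 1).
have exc : exists k, cross k by exists N; rewrite /cross eqxx.
pose k := ex_minn exc.
have [kN gk k1] : [/\ (k <= N)%N, forall j, (k <= j < N)%N -> g j <= 1 &
    forall j, (j < k)%N -> 1 <= g j].
  rewrite /k; case: ex_minnP => i ci imin; split.
  - by apply: imin; rewrite /cross eqxx.
  - move=> j /andP[ij jN]; case/orP: ci => [/eqP iN|gi].
      by move: jN; rewrite -iN ltnNge ij.
    by apply: le_trans gi; apply: gm; rewrite ij.
  - move=> j ji; rewrite leNgt; apply/negP => /ltW gj.
    by have := imin j; rewrite /cross gj orbT leqNgt ji => /(_ isT).
rewrite (big_cat_nat (leq0n k) kN)/=.
set P' := \sum_(k <= j < N) _.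
have -> : \sum_(0 <= j < k) Num.min (g j ^+ l) (g j) = \sum_(0 <= j < k) g j.
  apply: eq_big_nat => j /andP[_ jk]; apply/min_idPr.
  by rewrite -[leLHS]expr1 ler_weXn2l// k1.
set P := \sum_(0 <= j < k) g j.
have P'E : P' = \sum_(k <= j < N) g j ^+ l.
  apply: eq_big_nat => j /andP[kj jN]; apply/min_idPl.
  by rewrite -[leRHS]expr1 ler_wiXn2l ?g0// gk// kj.
have kP : k%:R <= P.
  rewrite -[k in k%:R]subn0 -sumr_const_nat big_nat /P [leRHS]big_nat.
  by apply: ler_sum => j /andP[_ jk]; exact: k1.
have [NP|PN] := leP N%:R P.
  rewrite (le_trans NP)// lerDl P'E big_nat sumr_ge0// => j /andP[_ jN].
  by rewrite exprn_ge0// g0.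
have kltN : (k < N)%N by rewrite -(ltr_nat R) (le_lt_trans kP).
have HP : \sum_(0 <= j < k) g j ^+ l * exp_step l j <= P ^+ l.
  apply: hardy_sum => // [i j /andP[ij jk]|j jk].
    by apply: gm; rewrite ij (leq_trans jk).
  by apply: g0; exact: leq_trans kN.
have HC : ((N - k)%:R - P') * (N%:R ^+ l - k%:R ^+ l) <=
    (N - k)%:R * (N%:R ^+ l - k%:R ^+ l - \sum_(k <= j < N) g j ^+ l * exp_step l j).
  have := chebyshev_sum k N (fun j => 1 - g j ^+ l) (exp_step l).
  rewrite sumrB sumr_const_nat -P'E sum_exp_step//.
  have -> : \sum_(k <= i < N) (1 - g i ^+ l) * exp_step l i =
      N%:R ^+ l - k%:R ^+ l - \sum_(k <= j < N) g j ^+ l * exp_step l j.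
    by rewrite -sum_exp_step// -sumrB; apply: eq_bigr => j _; rewrite mulrBl mul1r.
  apply => a b /andP[ka ab] bN.
    rewrite lerB// exp_le//; first exact: g0.
    by apply: gm; rewrite ab.
  exact: exp_step_le.
(* Convexity of the [l]-th power: [P] lies between [k] and [N], so its chord from [k] is no steeper
   than that of [N]. *)
have slope : (N%:R - k%:R) * (P ^+ l - k%:R ^+ l) <=
    (P - k%:R) * (N%:R ^+ l - k%:R ^+ l).
  rewrite -(opprB _ (P ^+ l)) -(opprB _ (N%:R ^+ l)) !subrXX -!mulNr !opprB mulrCA.
  rewrite ler_wpM2l ?subr_ge0// ler_wpM2l ?subr_ge0 ?ler_nat//.
  by apply: exp_slope_le => //; [exact: le_trans kP|exact: ltW].
have S0 : 0 < N%:R ^+ l - k%:R ^+ l :> R.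
  by rewrite subr_gt0 ltr_pXn2r ?nnegrE ?ltr_nat.
move: gN; rewrite (big_cat_nat (leq0n k) kN)/= => gN.
rewrite natrB// in HC; rewrite -lerBlDr -(lerD2r (- k%:R)) -(ler_pM2r S0).
apply: le_trans slope; rewrite (_ : _ - _ - _ = N%:R - k%:R - P'); last by ring.
apply: (le_trans HC); apply: ler_wpM2l; first by rewrite subr_ge0 ler_nat.
lra.
Qed.

Lemma region_staircase {R : realType} (l m N : nat) (a d : R) (f : nat -> R) :
  (0 < l)%N -> (0 < m)%N -> 0 <= a -> 0 < d -> a + N%:R * d = 1 ->
  (forall i j, (i <= j < N)%N -> f j <= f i) ->
  (forall j, (j < N)%N -> 0 <= f j <= a) ->
  region l.+1 m.+1
    ((N%:R * d) ^+ l.+1 + l.+1%:R * (d ^+ l * \sum_(0 <= j < N) f j * exp_step l j))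
    (a ^+ m.+1 + m.+1%:R * (d * \sum_(0 <= j < N) (a - f j) ^+ m)).
Proof.
move=> l0 m0 a0 d0 ab1 fm f0.
set b := N%:R * d; set J := d ^+ l * _; set S := \sum_(0 <= j < N) (a - f j) ^+ m.
have b0 : 0 <= b by rewrite mulr_ge0// ltW.
have bE : b = 1 - a by rewrite -ab1 addrC addKr.
have dl0 : 0 < d ^+ l by rewrite exprn_gt0.
have J0 : 0 <= J.
  rewrite mulr_ge0 ?(ltW dl0)// big_nat sumr_ge0// => j jN.
  rewrite mulr_ge0//; first by case/andP: (f0 j jN).
  by rewrite subr_ge0 exp_le// ler_nat.
have JE : J <= a * b ^+ l.
  have -> : a * b ^+ l = d ^+ l * \sum_(0 <= j < N) a * exp_step l j.
    rewrite -mulr_sumr sum_exp_step// expr0n eqn0Ngt l0/= subr0 exprMn.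
    by rewrite (mulrC (N%:R ^+ l)) mulrCA.
  rewrite /J ler_wpM2l ?(ltW dl0)// big_nat [leRHS]big_nat ler_sum// => j jN.
  rewrite ler_wpM2r//; last by case/andP: (f0 j jN).
  by rewrite subr_ge0 exp_le// ler_nat.
have Sle : S <= N%:R * a ^+ m.
  rewrite mulr_natl -[N in _ *+ N]subn0 -sumr_const_nat /S big_nat [leRHS]big_nat.
  rewrite ler_sum// => j jN; have /andP[fj0 fja] := f0 j jN.
  by apply: exp_le; lra.
move: (J0); rewrite le_eqVlt => /predU1P[<-|{}J0].
  exists b; first by lra.
  left; rewrite mulr0 addr0; split => //.
  rewrite /psi bE subKr lerD2l -mulrA ler_wpM2l// -bE.
  by rewrite (_ : a ^+ m * b = d * (N%:R * a ^+ m)) ?ler_wpM2l ?(ltW d0)//; rewrite /b; ring.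
have N0 : (0 < N)%N.
  rewrite lt0n; apply/eqP => N0; move: J0.
  by rewrite /J N0 big_geq// mulr0 ltxx.
have {}b0 : 0 < b by rewrite mulr_gt0// ltr0n.
have bl0 : 0 < b ^+ l by rewrite exprn_gt0.
(* The constant height of a staircase with the same independent density. *)
pose z := J / b ^+ l.
have z0 : 0 < z by rewrite divr_gt0.
have za : z <= a by rewrite ler_pdivrMr.
have zJ : z * b ^+ l = J by rewrite divfK ?gt_eqF.
have a_gt0 : 0 < a := lt_le_trans z0 za.
have [u u0 uz] := exists_root l z l0 (ltW z0).
have [v v0 va] := exists_root l a l0 a0.
have {}u0 : 0 < u.
  rewrite lt_neqAle u0 andbT eq_sym; apply: contraTneq z0 => u0'.
  by rewrite -uz u0' expr0n eqn0Ngt l0 ltxx.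
have {}v0 : 0 < v.
  rewrite lt_neqAle v0 andbT eq_sym; apply: contraTneq a_gt0 => v0'.
  by rewrite -va v0' expr0n eqn0Ngt l0 ltxx.
have uv : u <= v by rewrite -(ler_pXn2r l0) ?nnegrE ?(ltW u0) ?(ltW v0)// uz va.
pose c := Num.min (tail_ratio l m a u) (tail_ratio l m a v).
(* Normalised so that [g j ^+ l] is the height relative to [z]; the weighted sum of these is then
   exactly [N%:R ^+ l]. *)
pose g j := f j `^ l%:R^-1 / u.
have g0 j : 0 <= g j by rewrite divr_ge0 ?powR_ge0 ?(ltW u0).
have gE j : (j < N)%N -> g j ^+ l = f j / z.
  move=> jN; have /andP[fj _] := f0 j jN.
  by rewrite /g expr_div_n uz powR_invn_exp.
have gm i j : (i <= j < N)%N -> g j <= g i.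
  move=> /andP[ij jN]; rewrite -(ler_pXn2r l0) ?nnegrE// !gE//.
    by rewrite ler_pM2r ?invr_gt0// fm// ij.
  exact: leq_ltn_trans jN.
have gN : \sum_(0 <= j < N) g j ^+ l * exp_step l j = N%:R ^+ l.
  transitivity ((\sum_(0 <= j < N) f j * exp_step l j) / z); last first.
    apply/(mulfI (lt0r_neq0 dl0)); rewrite -exprMn (mulrC d) -/b mulrA -/J -zJ.
    by rewrite mulrAC divff ?mul1r ?gt_eqF.
  rewrite mulr_suml.
  by apply: eq_big_nat => j /andP[_ jN]; rewrite gE// mulrAC.
have := le_sum_min_exp l N g l0 gm (fun j _ => g0 j); rewrite gN lexx => /(_ isT) gmin.
have c0 : 0 <= c.
  rewrite le_min; apply/andP; split; rewrite mulr_ge0 ?invr_ge0 ?(ltW u0) ?(ltW v0)// subr_ge0;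
  by apply: exp_le; rewrite ?uz ?va; lra.
(* Heights up to [z] use concavity and the power [g j ^+ l]; greater heights use quasiconcavity of
   [tail_ratio] and [g j] itself. *)
have fc j : (j < N)%N -> c * u * Num.min (g j ^+ l) (g j) <= a ^+ m - (a - f j) ^+ m.
  move=> jN; have /andP[fj fja] := f0 j jN.
  have [fz|zf] := leP (f j) z.
    have := tail_excess_concave m a (f j) z fj fz za => h.
    rewrite -(ler_pM2l z0); apply: le_trans h.
    have cu : c * u <= a ^+ m - (a - z) ^+ m.
      have : c <= tail_ratio l m a u by rewrite ge_min lexx.
      by rewrite /tail_ratio uz ler_pdivlMr.
    apply: (@le_trans _ _ (f j * (c * u))); last by rewrite ler_wpM2l.
    have -> : f j * (c * u) = z * (c * u * g j ^+ l).
      by rewrite gE//; field; rewrite gt_eqF.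
    rewrite ler_wpM2l ?(ltW z0)// ler_wpM2l ?mulr_ge0 ?(ltW u0)//.
    by rewrite ge_min lexx.
  have gu : (u * g j) ^+ l = f j by rewrite exprMn uz gE// mulrCA divff ?mulr1 ?gt_eqF.
  have ug0 : 0 <= u * g j by rewrite mulr_ge0 ?(ltW u0).
  have ug : u <= u * g j by rewrite -(ler_pXn2r l0) ?nnegrE ?(ltW u0)// gu uz ltW.
  have gv : u * g j <= v by rewrite -(ler_pXn2r l0) ?nnegrE ?(ltW v0)// gu va.
  have := tail_ratio_quasiconcave l m a u (u * g j) v l0 m0 u0 ug gv va.
  rewrite -/c /tail_ratio gu ler_pdivlMr ?(lt_le_trans u0)//.
  apply: le_trans; rewrite -mulrA ler_wpM2l// ler_wpM2l ?(ltW u0)//.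
  by rewrite ge_min lexx orbT.
have Sc : S <= N%:R * (a ^+ m - c * u).
  have : c * u * N%:R <= N%:R * a ^+ m - S.
    apply: (@le_trans _ _ (c * u * \sum_(0 <= j < N) Num.min (g j ^+ l) (g j))).
      by rewrite ler_wpM2l// mulr_ge0// ltW.
    rewrite mulr_natl -[N in _ *+ N]subn0 -sumr_const_nat /S -sumrB mulr_sumr.
    by rewrite big_nat [leRHS]big_nat ler_sum.
  by rewrite mulrBr (mulrC N%:R (c * u)); lra.
have bSc : d * S <= b * (a ^+ m - c * u).
  by rewrite /b (mulrC N%:R) -mulrA ler_wpM2l// ltW.
have {}bSc : a ^+ m.+1 + m.+1%:R * (d * S) <= a ^+ m.+1 + m.+1%:R * (b * (a ^+ m - c * u)).
  by rewrite lerD2l ler_wpM2l.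
(* If the minimum [c] is attained at [u], the bound is that of the constant staircase of height
   [z]. *)
rewrite -zJ; have [cE|cE] := leP (tail_ratio l m a u) (tail_ratio l m a v).
  have cuE : c * u = a ^+ m - (a - z) ^+ m.
    by rewrite /c (min_idPl cE) /tail_ratio divfK ?gt_eqF// uz.
  rewrite cuE subKr in bSc.
  have := region_three_blocks l m (a - z) b z l0 m0; rewrite subr_ge0 za (ltW b0) (ltW z0).
  rewrite (_ : a - z + b + z = 1) => [/(_ isT isT isT erefl)|]; last lra.
  apply: region_le; first by rewrite -mulrA [_ ^+ l * z]mulrC.
  by rewrite (_ : 1 - b = a) ?mulrA in bSc *; lra.
(* Otherwise it is that of a staircase with height [a] on a fraction [u / v] of its length and 0
   beyond: three blocks with colours exchanged. *)
have cuE : c * u = a ^+ m * (u / v).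
  rewrite /c (min_idPr (ltW cE)) /tail_ratio va subrr expr0n eqn0Ngt m0 subr0 mulrAC mulrA.
  by rewrite mulrAC.
have uv0 : 0 <= u / v by rewrite divr_ge0 ?(ltW u0) ?(ltW v0).
have uv1 : u / v <= 1 by rewrite ler_pdivrMr// mul1r.
have y0 : 0 <= b * (u / v) by rewrite mulr_ge0 ?(ltW b0).
have yb : 0 <= b - b * (u / v) by rewrite subr_ge0 ler_piMr ?(ltW b0).
have y1 : b * (u / v) + a + (b - b * (u / v)) = 1 by rewrite bE; ring.
have := region_three_blocks m l _ _ _ m0 l0 y0 a0 yb y1.
move/region_sym; apply: region_le.
  rewrite -bE lerD2l -[leRHS]mulrA ler_wpM2l// [(b * _) ^+ l]exprMn expr_div_n uz va.
  by rewrite le_eqVlt; apply/orP; left; apply/eqP; field; rewrite gt_eqF.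
rewrite cuE in bSc.
by apply: (le_trans bSc); rewrite le_eqVlt; apply/orP; left; apply/eqP; ring.
Qed.

(** Normalising by n^k/k! instead of the binomial coefficient makes the bound exact for each graph,
    with no error term. *)
Lemma graph_region {R : realType} (l m n : nat) (G : sgraph 'I_n.+1) :
  (0 < l)%N -> (0 < m)%N ->
  region l.+1 m.+1
    (l.+1`!%:R * #|cliques (fun x y => ~~ adj G x y) l.+1|%:R / n.+1%:R ^+ l.+1)
    (m.+1`!%:R * #|cliques (adj G) m.+1|%:R / n.+1%:R ^+ m.+1 : R).
Proof.
move=> l0 m0; have [e [symm_e comp_e] [clq ind]] :=
  exists_compressed (adj G) l.+1 m.+1 (adj_sym _ G).
pose E i j := e (inord i) (inord j).
have [a [f [aN fm fa clqE indE]]] : exists a (f : nat -> nat),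
  [/\ (a <= n.+1)%N,
      forall i j, (i <= j < n.+1 - a)%N -> (f j <= f i)%N,
      forall j, (j < n.+1 - a)%N -> (f j <= a)%N,
      (m.+1`! * #|cliques (adj G) m.+1| <=
         a ^ m.+1 + m.+1 * \sum_(0 <= c < n.+1 - a) (a - f c) ^ m)%N &
      (l.+1`! * #|cliques (fun x y => ~~ adj G x y) l.+1| <=
         (n.+1 - a) ^ l.+1 + l.+1 * \sum_(0 <= c < n.+1 - a) f c * (c.+1 ^ l - c ^ l))%N].
  have [|u v y uv yN yu yv|a [f [aN fm fa clqE indE]]] := @compressed_staircase n.+1 E.
  - by move=> i j; rewrite /E symm_e.
  - by apply: comp_e; rewrite -1?val_eqE /= ?inordK//; lia.
  have [cl' ind'] := compressed_counts n l m e symm_e.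
  exists a, f; split=> //.
    by apply: leq_trans (clqE m); apply: leq_trans cl'; rewrite leq_mul2l clq orbT.
  by apply: leq_trans (indE l l0); apply: leq_trans ind'; rewrite leq_mul2l ind orbT.
have N0 : 0 < n.+1%:R :> R by rewrite ltr0n.
have Nn0 : n.+1%:R != 0 :> R by rewrite gt_eqF.
have a_ge0 : 0 <= a%:R / n.+1%:R :> R by rewrite divr_ge0.
have d_gt0 : 0 < n.+1%:R^-1 :> R by rewrite invr_gt0.
have abE : a%:R / n.+1%:R + (n.+1 - a)%:R * n.+1%:R^-1 = 1 :> R.
  by rewrite -mulrDl -natrD subnKC// divff.
pose g c : R := (f c)%:R / n.+1%:R.
have gm i j : (i <= j < n.+1 - a)%N -> g j <= g i.
  by move=> ij; rewrite ler_pM2r// ler_nat fm.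
have ga j : (j < n.+1 - a)%N -> 0 <= g j <= a%:R / n.+1%:R.
  by move=> jb; rewrite divr_ge0//= ler_pM2r// ler_nat fa.
apply: region_le (region_staircase l m (n.+1 - a) _ _ g l0 m0 a_ge0 d_gt0 abE gm ga).
  rewrite ler_pdivrMr ?exprn_gt0//.
  apply: (@le_trans _ _ ((n.+1 - a) ^ l.+1 + l.+1 *
      \sum_(0 <= c < n.+1 - a) f c * (c.+1 ^ l - c ^ l))%N%:R).
    by rewrite -natrM ler_nat.
  rewrite natrD natrM natr_sum natrX mulrDl -exprMn divfK// lerD2l.
  rewrite -mulrA ler_wpM2l// exprVn exprS mulrCA mulrAC mulVf ?expf_neq0// mul1r.
  rewrite mulr_sumr big_nat [leRHS]big_nat ler_sum// => c cb.
  rewrite natrM natrB ?leq_exp2r// !natrX /exp_step /g mulrA mulrCA.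
  by rewrite divff// mulr1.
rewrite ler_pdivrMr ?exprn_gt0//.
apply: (@le_trans _ _ (a ^ m.+1 + m.+1 *
    \sum_(0 <= c < n.+1 - a) (a - f c) ^ m)%N%:R).
  by rewrite -natrM ler_nat.
rewrite natrD natrM natr_sum natrX mulrDl -exprMn divfK// lerD2l.
rewrite -mulrA ler_wpM2l// exprS mulrACA mulVf// mul1r mulr_suml.
rewrite big_nat [leRHS]big_nat ler_sum// => c /andP[_ cb].
by rewrite natrX natrB ?fa// -mulrBl -exprMn divfK.
Qed.

(** * Limits of densities *)

Lemma bin_ratio_ge {R : realType} n t k : (k <= n)%N ->
  ((t - k)%:R / n%:R) ^+ k <= 'C(t, k)%:R / 'C(n, k)%:R :> R.
Proof.
move=> kn; have Cn0 : 0 < 'C(n, k)%:R :> R by rewrite ltr0n bin_gt0.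
have [->|k0] := posnP k; first by rewrite !bin0 divr1.
have n0 : (0 < n)%N := leq_trans k0 kn.
rewrite ler_pdivlMr// expr_div_n mulrAC ler_pdivrMr ?exprn_gt0 ?ltr0n//.
rewrite -!natrX -!natrM ler_nat -(leq_pmul2r (fact_gt0 k)) -mulnA bin_ffact.
by rewrite mulnAC bin_ffact leq_mul ?exp_sub_leq_ffact ?ffact_leq_exp.
Qed.

Lemma bin_pair_ratio_ge {R : realType} n t k : (k < n)%N ->
  ((n - t - k.+1)%:R / n%:R) ^+ k.+1 +
    k.+1%:R * ((n - t - k.+1)%:R / n%:R) ^+ k * (t%:R / n%:R) <=
  ('C(n - t, k.+1) + t * 'C(n - t, k))%:R / 'C(n, k.+1)%:R :> R.
Proof.
move=> kn; have Cn0 : 0 < 'C(n, k.+1)%:R :> R by rewrite ltr0n bin_gt0.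
have n0 : (0 < n)%N := leq_ltn_trans (leq0n k) kn.
have nR0 : n%:R != 0 :> R by rewrite pnatr_eq0 -lt0n.
rewrite natrD mulrDl lerD ?bin_ratio_ge//.
rewrite ler_pdivlMr// mulrA -(ler_pM2r (_ : 0 < n%:R ^+ k.+1)) ?exprn_gt0 ?ltr0n//.
rewrite [leLHS](_ : _ = k.+1%:R * (n - t - k.+1)%:R ^+ k * t%:R * 'C(n, k.+1)%:R); last first.
  rewrite expr_div_n exprS; field.
  by rewrite nR0 expf_neq0.
rewrite -!natrX -!natrM ler_nat -(leq_pmul2r (fact_gt0 k)).
have : (k.+1`! * 'C(n, k.+1) <= n ^ k.+1)%N by exact: fact_bin_leq_exp.
have : ((n - t - k.+1) ^ k <= 'C(n - t, k) * k`!)%N.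
  rewrite bin_ffact; apply: leq_trans (exp_sub_leq_ffact _ _).
  by case: k {kn Cn0} => // k; rewrite leq_exp2r//; lia.
rewrite factS; move: (_ ^ k)%N ('C(n, k.+1)) ('C(n - t, k)) (n ^ k.+1)%N (k`!) => A B C D F h1 h2.
have := leq_mul h1 h2 => h3.
rewrite [leqLHS](_ : _ = t * (A * (k.+1 * F * B)))%N; last by lia.
rewrite [leqRHS](_ : _ = t * (C * F * D))%N; last by lia.
by rewrite leq_mul2l h3 orbT.
Qed.

Lemma cvg_divn {R : realType} (c : R) : (fun n => c / n%:R) @ \oo --> (0 : R).
Proof.
rewrite -[X in _ --> X](mulr0 c); apply: cvgM; first exact: cvg_cst.
rewrite gtr0_cvgV0; first exact: cvgr_idn.
by exists 1%N => // n /= n0; rewrite ltr0n.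
Qed.

Lemma cvg_truncn_sub {R : realType} (y : R) k : 0 <= y ->
  (fun n => (Num.truncn (y * n%:R) - k)%:R / n%:R : R) @ \oo --> y.
Proof.
move=> y0; have lim : (fun n => y - k.+1%:R / n%:R) @ \oo --> y.
  by rewrite -[X in _ --> X]subr0; apply: cvgB; [exact: cvg_cst|exact: cvg_divn].
apply: squeeze_cvgr lim (cvg_cst y); exists 1%N => // n /= n0.
have n_gt0 : 0 < n%:R :> R by rewrite ltr0n.
have /truncn_itv/andP[] : 0 <= y * n%:R by rewrite mulr_ge0.
move: (Num.truncn _) => t; rewrite -natr1 => t1 t2.
rewrite ler_pdivlMr// ler_pdivrMr// mulrBl divfK ?gt_eqF//; apply/andP; split.
  have : t%:R <= (t - k)%:R + k%:R :> R by rewrite -natrD ler_nat; lia.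
  by rewrite -natr1; lra.
by apply: le_trans t1; rewrite ler_nat leq_subr.
Qed.

Lemma cvg_truncn_compl {R : realType} (y : R) k : 0 <= y <= 1 ->
  (fun n => (n - Num.truncn (y * n%:R) - k)%:R / n%:R : R) @ \oo --> 1 - y.
Proof.
move=> /andP[y0 y1].
have lim1 : (fun n => 1 - y - k%:R / n%:R) @ \oo --> 1 - y.
  by rewrite -[X in _ --> X]subr0; apply: cvgB; [exact: cvg_cst|exact: cvg_divn].
have lim2 : (fun n => 1 - y + 1 / n%:R) @ \oo --> 1 - y.
  by rewrite -[X in _ --> X]addr0; apply: cvgD; [exact: cvg_cst|exact: cvg_divn].
apply: squeeze_cvgr lim1 lim2; exists 1%N => // n /= n0.
have n_gt0 : 0 < n%:R :> R by rewrite ltr0n.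
have /truncn_itv/andP[] : 0 <= y * n%:R by rewrite mulr_ge0.
move: (Num.truncn _) => t; rewrite -natr1 => t1 t2.
have tn : (t <= n)%N by rewrite -(ler_nat R) (le_trans t1)// ler_piMl.
rewrite ler_pdivlMr// ler_pdivrMr// mulrBl [(_ + 1 / _) * _]mulrDl !divfK ?gt_eqF//.
apply/andP; split.
  have : n%:R <= (n - t - k)%:R + k%:R + t%:R :> R by rewrite -!natrD ler_nat; lia.
  lra.
have : (n - t - k)%:R + t%:R <= n%:R :> R by rewrite -natrD ler_nat; lia.
lra.
Qed.

Lemma cvg_exp {R : realType} (u : nat -> R) (x : R) k : u @ \oo --> x ->
  (fun n => u n ^+ k) @ \oo --> x ^+ k.
Proof. by move=> ux; exact: (continuous_cvg _ (@exprn_continuous R k x) ux). Qed.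

Lemma near_bin_ratio {R : realType} (y z : R) k : 0 <= y -> z < y ^+ k ->
  \forall n \near \oo, z <= 'C(Num.truncn (y * n%:R), k)%:R / 'C(n, k)%:R.
Proof.
move=> y0 zy; have lim := cvg_exp _ _ k (cvg_truncn_sub y k y0).
near=> n; apply: le_trans (bin_ratio_ge n _ k _); last by near: n; exists k.
by near: n; exact: (cvgr_ge _ lim).
Unshelve. all: end_near. Qed.

Lemma near_bin_pair_ratio {R : realType} (y z : R) k : 0 <= y <= 1 ->
  z < psi k.+1 (1 - y) ->
  \forall n \near \oo,
    z <= ('C(n - Num.truncn (y * n%:R), k.+1) +
          Num.truncn (y * n%:R) * 'C(n - Num.truncn (y * n%:R), k))%:R / 'C(n, k.+1)%:R.
Proof.
move=> y01 zy; have lim := cvg_truncn_compl y k.+1 y01.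
have y0 : 0 <= y by case/andP: y01.
have lim_t := cvg_truncn_sub y 0 y0.
pose u n : R := (n - Num.truncn (y * n%:R) - k.+1)%:R / n%:R.
pose v n : R := (Num.truncn (y * n%:R) - 0)%:R / n%:R.
have {lim_t}lim : (fun n => u n ^+ k.+1 + k.+1%:R * u n ^+ k * v n) @ \oo --> psi k.+1 (1 - y).
  rewrite /psi subKr; apply: cvgD; first exact: cvg_exp.
  by apply: cvgM lim_t; apply: cvgM; [exact: cvg_cst|exact: cvg_exp].
near=> n; have kn : (k < n)%N by near: n; exists k.+1.
have : z <= u n ^+ k.+1 + k.+1%:R * u n ^+ k * v n by near: n; exact: (cvgr_ge _ lim).
move=> /le_trans; apply; rewrite /v subn0; exact: bin_pair_ratio_ge.
Unshelve. all: end_near. Qed.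

Lemma densityE {R : realType} (n k : nat) (G : sgraph 'I_n) :
  density R (complete 'I_k) G = #|cliques (adj G) k|%:R / 'C(n, k)%:R /\
  density R (edgeless 'I_k) G = #|cliques (fun x y => ~~ adj G x y) k|%:R / 'C(n, k)%:R.
Proof. by rewrite /density !card_ord Ind_complete Ind_edgeless. Qed.

Lemma density_complete_itv {R : realType} (n k : nat) (G : sgraph 'I_n) : (k <= n)%N ->
  0 <= density R (complete 'I_k) G <= 1.
Proof.
move=> kn; rewrite (densityE n k G).1 divr_ge0//= ler_pdivrMr ?ltr0n ?bin_gt0//.
rewrite mul1r ler_nat -[n in 'C(n, _)]card_ord -card_draws.
by apply/subset_leq_card/fintype.subsetP => X /cliquesP[Xk _]; rewrite inE Xk.
Qed.

(** The extra factors convert binomial normalisation into that of [graph_region]; they tend to 1. *)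
Lemma density_region {R : realType} (n r s : nat) (G : sgraph 'I_n) :
  (1 < r)%N -> (1 < s)%N -> (maxn r s <= n)%N ->
  region r s (density R (edgeless 'I_r) G * ((n ^_ r)%:R / n%:R ^+ r))
             (density R (complete 'I_s) G * ((n ^_ s)%:R / n%:R ^+ s)).
Proof.
case: r => [|l]//; case: s => [|m]// l0 m0; rewrite geq_max => /andP[rn sn].
case: n G rn sn => // n G rn sn.
have scale k (c : R) : (k <= n.+1)%N ->
    c / 'C(n.+1, k)%:R * ((n.+1 ^_ k)%:R / n.+1%:R ^+ k) = k`!%:R * c / n.+1%:R ^+ k.
  move=> kn; rewrite -bin_ffact natrM.
  have C0 : 'C(n.+1, k)%:R != 0 :> R by rewrite pnatr_eq0 -lt0n bin_gt0.
  by rewrite mulrA (mulrA (c / _)) divfK// [_ * k`!%:R]mulrC.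
rewrite (densityE _ _ G).1 (densityE _ _ G).2 !scale//.
exact: graph_region.
Qed.

Lemma near_ffact_ratio {R : realType} (z : R) k : z < 1 ->
  \forall n \near \oo, z <= (n ^_ k)%:R / n%:R ^+ k.
Proof.
move=> z1.
(* The factor 1 is kept to match [cvg_truncn_sub] at [y = 1]. *)
have lim : (fun n => ((Num.truncn (1 * n%:R : R) - k)%:R / n%:R) ^+ k) @ \oo --> (1 : R).
  rewrite -[X in _ --> X](expr1n R k); exact: cvg_exp (cvg_truncn_sub 1 k ler01).
near=> n; have n0 : (0 < n)%N by near: n; exists 1%N.
have : z <= ((Num.truncn (1 * n%:R : R) - k)%:R / n%:R) ^+ k.
  by near: n; exact: (cvgr_ge _ lim).
move=> /le_trans; apply; rewrite mul1r natrK expr_div_n ler_pM2r; last first.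
  by rewrite invr_gt0 exprn_gt0 ?ltr0n.
by rewrite -natrX ler_nat exp_sub_leq_ffact.
Unshelve. all: end_near. Qed.

(** * Slack along the extremal curves and the asymptotic upper bound *)

Lemma continuous_dist {R : realType} (f : R -> R) (x e : R) : continuous f -> 0 < e ->
  exists2 d : R, 0 < d & forall y, `|x - y| < d -> `|f x - f y| <= e.
Proof.
move=> fc e0; have /cvgrPdist_le/(_ e e0) := fc x.
by move=> /nbhs_ballP[d /= d0 h]; exists d => // y /h.
Qed.

(* A loss of a factor [c] close to 1 in the constraint [phi] costs at most [e] in
   the objective [chi]; stated so that no inverse of [phi] is needed. *)
Lemma curve_before {R : realType} (phi chi : R -> R) (x e : R) : 0 <= x <= 1 -> phi 0 = 0 ->
  (forall y z, 0 <= y -> y < z -> z <= 1 -> phi y < phi z) ->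
  (forall y z, 0 <= y -> y <= z -> z <= 1 -> chi z <= chi y) ->
  continuous chi -> 0 < e ->
  exists2 c : R, c < 1 & forall y, 0 <= y <= 1 -> c * phi x <= phi y -> chi y <= chi x + e.
Proof.
move=> /andP[x0 x1] phi0 phi_lt chi_le chic e0.
move: x0; rewrite le_eqVlt => /predU1P[<-|x0].
  exists 0 => // y /andP[y0 y1] _; have := chi_le 0 y (lexx _) y0 y1; lra.
have [d d0 chid] := continuous_dist chi x e chic e0.
(* A point so little before [x] that [chi] exceeds [chi x] there by at most [e]; the factor sought
   is [phi x' / phi x]. *)
pose x' := Num.max 0 (x - d / 2).
have x'0 : 0 <= x' by rewrite le_max lexx.
have x'x : x' < x by rewrite gt_max x0; lra.
have phix : 0 < phi x by rewrite -phi0; exact: phi_lt.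
exists (phi x' / phi x); first by rewrite ltr_pdivrMr// mul1r; exact: phi_lt.
move=> y /andP[y0 y1]; rewrite divfK ?gt_eqF// => phixy.
have x'y : x' <= y.
  by rewrite leNgt; apply/negP => yx'; have := phi_lt y x' y0 yx'; lra.
have := chi_le x' y x'0 x'y y1; have /chid : `|x - x'| < d.
  rewrite ger0_norm ?subr_ge0 ?ltW//.
  have : x - d / 2 <= x' by rewrite le_max lexx orbT.
  lra.
rewrite distrC => /ler_normlW; lra.
Qed.

(** For the lower bounds: a small step past [x] makes the constraint strict, so that it survives
    rounding to integer sizes. *)
Lemma curve_after {R : realType} (chi : R -> R) (x e : R) : x < 1 ->
  continuous chi -> 0 < e -> exists2 y : R, x < y < 1 & chi x - e < chi y.
Proof.
move=> x1 chic e0; have [|d d0 chid] := continuous_dist chi x (e / 2) chic; first lra.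
pose y := Num.min (x + d / 2) ((x + 1) / 2); exists y.
  by rewrite /y lt_min gt_min; lra.
have xy : x < y by rewrite lt_min; lra.
have /chid : `|x - y| < d.
  rewrite distrC ger0_norm ?subr_ge0 ?ltW//.
  have : y <= x + d / 2 by rewrite ge_min lexx.
  lra.
move=> /ler_normlW; lra.
Qed.

Lemma exp_lt {R : realType} (n : nat) (x y : R) : (0 < n)%N -> 0 <= x -> x < y ->
  x ^+ n < y ^+ n.
Proof. by move=> n0 x0 xy; rewrite ltr_pXn2r ?nnegrE// (le_trans x0)// ltW. Qed.

Lemma exp1B_continuous {R : realType} (k : nat) : continuous (fun x : R => (1 - x) ^+ k).
Proof.
move=> x; apply: (@continuous_cvg _ _ _ _ _ _ (fun y : R => y ^+ k)).
  exact: exprn_continuous.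
by apply: cvgB; [exact: cvg_cst|exact: cvg_id].
Qed.

Lemma psi1B_continuous {R : realType} (k : nat) : continuous (fun x : R => psi k (1 - x)).
Proof.
move=> x; apply: (@continuous_cvg _ _ _ _ _ _ (psi k)).
  exact: psi_continuous.
by apply: cvgB; [exact: cvg_cst|exact: cvg_id].
Qed.

Lemma exp1B_le {R : realType} (k : nat) (y z : R) : 0 <= y -> y <= z -> z <= 1 ->
  (1 - z) ^+ k <= (1 - y) ^+ k.
Proof. by move=> y0 yz z1; apply: exp_le; lra. Qed.

Lemma psi1B_le {R : realType} (k : nat) (y z : R) : (1 < k)%N -> 0 <= y -> y <= z -> z <= 1 ->
  psi k (1 - z) <= psi k (1 - y).
Proof. by move=> k1 y0 yz z1; apply: psi_le => //; lra. Qed.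

Lemma near_density_complete_le {R : realType} (r s : nat) (p b q e : R) :
  (1 < r)%N -> (1 < s)%N -> 0 <= b <= 1 -> b ^+ r = p -> 0 <= q <= 1 -> psi r q = p ->
  0 < e ->
  \forall n \near \oo, forall G : sgraph 'I_n, p <= density R (edgeless 'I_r) G ->
    density R (complete 'I_s) G <= Num.max (psi s (1 - b)) ((1 - q) ^+ s) + e.
Proof.
move=> r1 s1 b01 bp q01 qp e0; have e20 : 0 < e / 2 by lra.
have r0 : (0 < r)%N := ltnW r1.
have [c1 c1lt c1P] := curve_before (fun x => x ^+ r) (fun x => psi s (1 - x)) b (e / 2) b01
  (etrans (expr0n _ _) (congr1 (fun c : bool => c%:R) (gtn_eqF r0)))
  (fun y z y0 yz _ => exp_lt r y z r0 y0 yz)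
  (fun y z => psi1B_le s y z s1) (psi1B_continuous s) e20.
have [c2 c2lt c2P] := curve_before (psi r) (fun x => (1 - x) ^+ s) q (e / 2) q01 (psi0 r r1)
  (fun y z => psi_lt r y z r1) (exp1B_le s) (exp1B_continuous s) e20.
have p0 : 0 <= p by rewrite -bp exprn_ge0//; case/andP: b01.
near=> n => G dG; have rsn : (maxn r s <= n)%N by near: n; exists (maxn r s).
have h1 : c1 <= (n ^_ r)%:R / n%:R ^+ r by near: n; exact: near_ffact_ratio.
have h2 : c2 <= (n ^_ r)%:R / n%:R ^+ r by near: n; exact: near_ffact_ratio.
have h3 : 1 - e / 2 <= (n ^_ s)%:R / n%:R ^+ s.
  by near: n; apply: near_ffact_ratio; lra.
have [y y01 reg] := @density_region R n r s G r1 s1 rsn.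
have : p * ((n ^_ r)%:R / n%:R ^+ r) <=
    density R (edgeless 'I_r) G * ((n ^_ r)%:R / n%:R ^+ r).
  by rewrite ler_wpM2r// divr_ge0// exprn_ge0.
move: h1 h2 h3 reg.
have := @density_complete_itv R n s G (leq_trans (leq_maxr r s) rsn).
move: (density R (edgeless _) G) (density R (complete _) G) => I K.
move: ((n ^_ r)%:R / _) ((n ^_ s)%:R / _) => x z K01 xc1 xc2 hz reg pI.
have : K * z <= Num.max (psi s (1 - b)) ((1 - q) ^+ s) + e / 2.
  case: reg => -[Iy Ky]; apply: (le_trans Ky).
    have : psi s (1 - y) <= psi s (1 - b) + e / 2.
      by apply: c1P => //=; rewrite bp; nra.
    by move=> /le_trans; apply; rewrite lerD2r le_max lexx.
  have : (1 - y) ^+ s <= (1 - q) ^+ s + e / 2.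
    by apply: c2P => //=; rewrite qp; nra.
  by move=> /le_trans; apply; rewrite lerD2r le_max lexx orbT.
have /andP[K0 K1] := K01.
(* The other half of [e] pays for the factor [z], as [K <= 1]. *)
have h1 : K * (1 - z) <= K * (e / 2) by rewrite ler_wpM2l//; lra.
have h2 : K * (e / 2) <= e / 2 by rewrite ler_piMl ?(ltW e20).
by move: (Num.max _ _) h1 => m; rewrite mulrBr mulr1; lra.
Unshelve. all: end_near. Qed.

(* Choosing the best feasible size, instead of rounding the limit size, makes the
   graph feasible for every [n] and not only for large [n]. *)
Definition best_size {R : realType} (r s : nat) (p : R) (F : forall n, nat -> sgraph 'I_n)
    (n t : nat) : Prop :=
  [/\ (0 < t <= n)%N, feasible r p (F n t) &
   forall u, (0 < u <= n)%N -> feasible r p (F n u) ->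
     density R (complete 'I_s) (F n u) <= density R (complete 'I_s) (F n t)].

Lemma exists_best_size {R : realType} (r s : nat) (p : R) (F : forall n, nat -> sgraph 'I_n)
    (n t : nat) : (0 < t <= n)%N -> feasible r p (F n t) ->
  exists u, best_size r s p F n u.
Proof.
move=> /andP[t0 tn] tf.
pose P (i : 'I_n.+1) := (0 < i)%N && feasible r p (F n i).
have Pt : P (Ordinal (tn : t < n.+1)%N) by rewrite /P /= t0.
case: (arg_maxP (fun i : 'I_n.+1 => density R (complete 'I_s) (F n i)) Pt) => u /andP[u0 uf] umax.
exists u; split=> // [|v /andP[v0 vn] vf]; first by rewrite u0 -ltnS ltn_ord.
by apply: (umax (Ordinal (vn : v < n.+1)%N)); rewrite /P /= v0.
Qed.

Lemma exists_best_sizes {R : realType} (r s : nat) (p : R) (F : forall n, nat -> sgraph 'I_n) N :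
  (forall n, (N <= n)%N -> exists2 t, (0 < t <= n)%N & feasible r p (F n t)) ->
  exists t : nat -> nat, forall n, (N <= n)%N -> best_size r s p F n (t n).
Proof.
move=> ex; have pick n : exists t, (N <= n)%N -> best_size r s p F n t.
  (* Nothing is claimed below [N], so 0 is a dummy value. *)
  have [Nn|nN] := leqP N n; last by exists 0%N.
  have [t tn tf] := ex n Nn.
  by have [u uP] := exists_best_size r s p F n t tn tf; exists u.
by have [t tP] := choice pick; exists t.
Qed.

(** * Feasible extremal graphs and the asymptotic lower bounds *)

Lemma feasible_Q1 {R : realType} (r : nat) (p : R) (n : nat) : (0 < r <= n)%N -> p <= 1 ->
  feasible r p (Q n 1).
Proof.
case: r => [|r]//= rn p1; rewrite /feasible (le_trans p1)// (densityE n _ _).2.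
rewrite ler_pdivlMr ?ltr0n ?bin_gt0// mul1r ler_nat.
apply: leq_trans (leq_bin_indep_Q n 1 r (leq_ltn_trans (leq0n r) rn)).
(* A clique on one vertex has no edge; Pascal's rule adds the two counts up to all sets. *)
by case: n rn => // n _; rewrite subn1 mul1n binS.
Qed.

Lemma cliques_Qbar n t k : cliques (adj (Qbar n t)) k = cliques (fun x y => ~~ adj (Q n t) x y) k.
Proof. by apply: eq_cliques => x y; exact: adj_Qbar. Qed.

Lemma indep_Qbar n t k : cliques (fun x y => ~~ adj (Qbar n t) x y) k = cliques (adj (Q n t)) k.
Proof. by apply: eq_cliques => x y xy; rewrite adj_Qbar// negbK. Qed.

Lemma feasible_Qbarn {R : realType} (r : nat) (p : R) (n : nat) : (r <= n)%N -> p <= 1 ->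
  feasible r p (Qbar n n).
Proof.
move=> rn p1; rewrite /feasible (le_trans p1)// (densityE n _ _).2 indep_Qbar.
rewrite ler_pdivlMr ?ltr0n ?bin_gt0// mul1r ler_nat.
exact: leq_bin_cliques_Q.
Qed.

Lemma near_truncn_itv {R : realType} (y : R) : 0 < y <= 1 ->
  \forall n \near \oo, (0 < Num.truncn (y * n%:R) <= n)%N.
Proof.
move=> /andP[y0 y1]; have lim := cvg_truncn_sub y 0 (ltW y0).
near=> n; have n0 : (0 < n)%N by near: n; exists 1%N.
have n_gt0 : 0 < n%:R :> R by rewrite ltr0n.
have : 0 < (Num.truncn (y * n%:R) - 0)%:R / n%:R :> R by near: n; exact: (cvgr_gt _ lim).
rewrite subn0 pmulr_lgt0 ?invr_gt0// ltr0n => -> /=.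
have /truncn_itv/andP[t1 _] : 0 <= y * n%:R by rewrite mulr_ge0 ?ltW.
by rewrite -(ler_nat R) (le_trans t1)// ler_piMl.
Unshelve. all: end_near. Qed.

(** For a point [x] just past [q], truncating (1 - x)n gives a clique size that is feasible for
    large [n]; the best size does at least as well. For [q = 1] the bound is negative. *)
Lemma near_Q_density {R : realType} (r s : nat) (p q e : R) (t : nat -> nat) N :
  (1 < r)%N -> (1 < s)%N -> 0 <= q <= 1 -> psi r q = p -> 0 < e ->
  (forall n, (N <= n)%N -> best_size r s p Q n (t n)) ->
  \forall n \near \oo, (1 - q) ^+ s - e <= density R (complete 'I_s) (Q n (t n)).
Proof.
move=> r1 s1 /andP[q0]; rewrite le_eqVlt => /predU1P[-> _|q1 qp] e0 tP.
  near=> n; have sn : (s <= n)%N by near: n; exists s.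
  have /andP[d0 _] := @density_complete_itv R n s (Q n (t n)) sn.
  by apply: le_trans d0; rewrite subrr expr0n gtn_eqF ?(ltnW s1)// sub0r oppr_le0 ltW.
have [x /andP[qx x1] hx] := curve_after (fun x => (1 - x) ^+ s) q e q1 (exp1B_continuous s) e0.
have x0 : 0 < x := le_lt_trans q0 qx.
have px : p < psi r x by rewrite -qp psi_lt// ltW.
have y01 : 0 < 1 - x <= 1 by lra.
have y01' : 0 <= 1 - x <= 1 by lra.
case: r r1 qp px tP => // r r1 qp px tP.
near=> n; have Nn : (N <= n)%N by near: n; exists N.
have sn : (s <= n)%N by near: n; exists s.
have tn : (0 < Num.truncn ((1 - x) * n%:R) <= n)%N by near: n; exact: near_truncn_itv.
have [_ _ best] := tP n Nn; apply: le_trans (best _ tn _).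
  rewrite (densityE n s _).1.
  have : (1 - q) ^+ s - e <= 'C(Num.truncn ((1 - x) * n%:R), s)%:R / 'C(n, s)%:R.
    by near: n; apply: near_bin_ratio => //; case/andP: y01'.
  move=> /le_trans; apply; rewrite ler_pM2r ?invr_gt0 ?ltr0n ?bin_gt0// ler_nat.
  by apply: leq_bin_cliques_Q; case/andP: tn.
rewrite /feasible (densityE n r.+1 _).2.
have : p <= ('C(n - Num.truncn ((1 - x) * n%:R), r.+1) + Num.truncn ((1 - x) * n%:R) *
    'C(n - Num.truncn ((1 - x) * n%:R), r))%:R / 'C(n, r.+1)%:R.
  by near: n; apply: near_bin_pair_ratio; rewrite ?subKr.
move=> /le_trans; apply; rewrite ler_pM2r ?invr_gt0 ?ltr0n ?bin_gt0// ?ler_nat.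
  by apply: leq_bin_indep_Q; case/andP: tn.
by near: n; exists r.+1.
Unshelve. all: end_near. Qed.

Lemma near_Qbar_density {R : realType} (r s : nat) (p b e : R) (t : nat -> nat) N :
  (1 < r)%N -> (1 < s)%N -> 0 <= b <= 1 -> b ^+ r = p -> 0 < e ->
  (forall n, (N <= n)%N -> best_size r s p Qbar n (t n)) ->
  \forall n \near \oo, psi s (1 - b) - e <= density R (complete 'I_s) (Qbar n (t n)).
Proof.
move=> r1 s1 /andP[b0]; rewrite le_eqVlt => /predU1P[-> _|b1 bp] e0 tP.
  near=> n; have sn : (s <= n)%N by near: n; exists s.
  have /andP[d0 _] := @density_complete_itv R n s (Qbar n (t n)) sn.
  by apply: le_trans d0; rewrite subrr psi0// sub0r oppr_le0 ltW.
have [x /andP[bx x1] hx] := curve_after (fun x => psi s (1 - x)) b e b1 (psi1B_continuous s) e0.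
have x0 : 0 < x := le_lt_trans b0 bx.
have px : p < x ^+ r by rewrite -bp exp_lt// ltnW.
have x01 : 0 < x <= 1 by lra.
have x01' : 0 <= x <= 1 by lra.
case: s s1 hx tP => // s s1 hx tP.
near=> n; have Nn : (N <= n)%N by near: n; exists N.
have tn : (0 < Num.truncn (x * n%:R) <= n)%N by near: n; exact: near_truncn_itv.
have [_ _ best] := tP n Nn; apply: le_trans (best _ tn _).
  rewrite (densityE n s.+1 _).1 cliques_Qbar.
  have : psi s.+1 (1 - b) - e <= ('C(n - Num.truncn (x * n%:R), s.+1) +
      Num.truncn (x * n%:R) * 'C(n - Num.truncn (x * n%:R), s))%:R / 'C(n, s.+1)%:R.
    by near: n; exact: near_bin_pair_ratio.
  move=> /le_trans; apply; rewrite ler_pM2r ?invr_gt0 ?ltr0n ?bin_gt0// ?ler_nat.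
    by apply: leq_bin_indep_Q; case/andP: tn.
  by near: n; exists s.+1.
rewrite /feasible (densityE n r _).2 indep_Qbar.
have : p <= 'C(Num.truncn (x * n%:R), r)%:R / 'C(n, r)%:R.
  by near: n; apply: near_bin_ratio => //; exact: ltW.
move=> /le_trans; apply; rewrite ler_pM2r ?invr_gt0 ?ltr0n ?bin_gt0// ?ler_nat.
  by apply: leq_bin_cliques_Q; case/andP: tn.
by near: n; exists r.
Unshelve. all: end_near. Qed.

Lemma cvg_of_near_bounds {R : realType} (d m : nat -> R) (l : R) :
  (\forall n \near \oo, d n <= m n) ->
  (forall e, 0 < e -> \forall n \near \oo, m n <= l + e) ->
  (forall e, 0 < e -> \forall n \near \oo, l - e <= d n) ->
  (fun n => m n - l) @ \oo --> (0 : R) /\ (fun n => m n - d n) @ \oo --> (0 : R).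
Proof.
move=> dm ml ld; split; apply/cvgrPdist_le => e e0.
  near=> n; have h1 : d n <= m n by near: n.
  have h2 : m n <= l + e by near: n; exact: ml.
  have h3 : l - e <= d n by near: n; exact: ld.
  by rewrite sub0r normrN ler_norml; lra.
have e20 : 0 < e / 2 by lra.
near=> n; have h1 : d n <= m n by near: n.
have h2 : m n <= l + e / 2 by near: n; exact: ml.
have h3 : l - e / 2 <= d n by near: n; exact: ld.
by rewrite sub0r normrN ler_norml; lra.
Unshelve. all: end_near. Qed.

Lemma density_le_max_density {R : realType} (r s : nat) (p : R) (n : nat) (G : sgraph 'I_n) :
  feasible r p G -> density R (complete 'I_s) G <= max_density r s p n.
Proof. by move=> Gf; rewrite /max_density; exact: le_bigmax_cond. Qed.

Theorem theorem1p1 (R : realType) (r s : nat) (p : R)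
    (hr : (2 <= r)%N) (hs : (2 <= s)%N) (hp : 0 <= p <= 1) :
  exists q : R, unique (is_q r p) q /\
  (exists e : nat -> R, e @ \oo --> (0 : R) /\
     forall (n : nat) (G : sgraph 'I_n), (maxn r s <= n)%N ->
       p <= density R (edgeless 'I_r) G ->
       density R (complete 'I_s) G <= M r s p q + e n) /\
  (exists t t' : nat -> nat,
     (forall n : nat, (maxn r s <= n)%N ->
        [/\ (0 < t n <= n)%N, (0 < t' n <= n)%N,
            feasible r p (Q n (t n)) & feasible r p (Qbar n (t' n))]) /\
     ((fun n : nat => max_density r s p n
                      - density R (complete 'I_s) (Q n (t n)))
        @ \oo --> (0 : R) \/
      (fun n : nat => max_density r s p n
                      - density R (complete 'I_s) (Qbar n (t' n)))
        @ \oo --> (0 : R))).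
Proof.
have /andP[p0 p1] := hp; have r0 : (0 < r)%N := ltnW hr.
have is_qE q : is_q r p q <-> 0 <= q <= 1 /\ psi r q = p by rewrite /is_q /psi subn1.
have [q q01 qp] : exists2 q : R, 0 <= q <= 1 & psi r q = p.
  by apply: psi_solve => //; rewrite psi1 p0.
exists q; split.
  split=> [|q' /is_qE[q'01 q'p]]; first exact/is_qE.
  have /andP[q0 q1] := q01; have /andP[q'0 q'1] := q'01.
  apply/eqP; case: ltgtP => // qq'.
    by have := psi_lt r q q' hr q0 qq' q'1; rewrite qp q'p ltxx.
  by have := psi_lt r q' q hr q'0 qq' q1; rewrite qp q'p ltxx.
pose b : R := p `^ r%:R^-1.
have b0 : 0 <= b by exact: powR_ge0.
have bp : b ^+ r = p by exact: powR_invn_exp.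
have b1 : b <= 1.
  rewrite leNgt; apply/negP => b1.
  by have := exp_lt r 1 b r0 ler01 b1; rewrite bp expr1n ltNge p1.
have b01 : 0 <= b <= 1 by rewrite b0.
have ME : M r s p q = Num.max (psi s (1 - b)) ((1 - q) ^+ s).
  by rewrite /M -/b /psi subKr subn1 mulrAC.
have [t tP] : exists t : nat -> nat, forall n, (maxn r s <= n)%N -> best_size r s p Q n (t n).
  apply: exists_best_sizes => n; rewrite geq_max => /andP[rn sn].
  exists 1%N; first exact: leq_trans r0 rn.
  by apply: feasible_Q1; rewrite ?r0.
have [t' t'P] : exists t : nat -> nat, forall n, (maxn r s <= n)%N -> best_size r s p Qbar n (t n).
  apply: exists_best_sizes => n; rewrite geq_max => /andP[rn sn].
  exists n; first by rewrite leqnn (leq_trans r0 rn).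
  exact: feasible_Qbarn.
(* The maximum defining [max_density] starts from the default 0, which must also lie below the
   bound. *)
have M0 : 0 <= M r s p q by rewrite ME le_max exprn_ge0 ?orbT// subr_ge0; case/andP: q01.
have upper e : 0 < e -> \forall n \near \oo, max_density r s p n <= M r s p q + e.
  move=> e0; have := near_density_complete_le r s p b q e hr hs b01 bp q01 qp e0.
  apply: filterS => n h; rewrite /max_density ME; apply: bigmax_le => //.
  by rewrite -ME addr_ge0 // ltW.
have le_t : \forall n \near \oo, density R (complete 'I_s) (Q n (t n)) <= max_density r s p n.
  by exists (maxn r s) => // n /= /tP[_ tf _]; exact: density_le_max_density.
have le_t' : \forall n \near \oo, density R (complete 'I_s) (Qbar n (t' n)) <= max_density r s p n.
  by exists (maxn r s) => // n /= /t'P[_ tf _]; exact: density_le_max_density.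
have [cvgM cvg_t] : (fun n => max_density r s p n - M r s p q) @ \oo --> (0 : R) /\
   ((fun n => max_density r s p n - density R (complete 'I_s) (Q n (t n))) @ \oo --> (0 : R) \/
    (fun n => max_density r s p n - density R (complete 'I_s) (Qbar n (t' n))) @ \oo --> (0 : R)).
  (* The larger term of the maximum decides which family is asymptotically optimal. *)
  have [le_bq|lt_qb] := leP (psi s (1 - b)) ((1 - q) ^+ s).
    have [|h1 h2] := cvg_of_near_bounds _ _ (M r s p q) le_t upper; last by split; [|left].
    move=> e e0; rewrite ME (max_idPr le_bq).
    exact: (near_Q_density r s p q e t (maxn r s)).
  have [|h1 h2] := cvg_of_near_bounds _ _ (M r s p q) le_t' upper; last by split; [|right].
  move=> e e0; rewrite ME (max_idPl (ltW lt_qb)).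
  exact: (near_Qbar_density r s p b e t' (maxn r s)).
split.
  (* With this error term the bound holds for every [n], by the definition of the maximum. *)
  exists (fun n => max_density r s p n - M r s p q); split=> // n G _ Gf.
  by rewrite addrC subrK; exact: density_le_max_density.
exists t, t'; split=> // n nrs; have [t1 t2 _] := tP n nrs; have [t'1 t'2 _] := t'P n nrs.
by split.
Qed.
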